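(* Let $\hat\phi_{2n+\epsilon}$, $\hat l_0^n$ and $\hat u_{m,n,\epsilon}$ denote the Fourier transforms of $\phi_{2n+\epsilon}$, $l_0^n$ and $u_{2n+1+\epsilon,2n-2m}$ respectively, where $\epsilon\in\{0,1\}$ and $\hat g(w)=\int_{-1}^1e^{-iwt}g(t)\,dt$. Then: (1) for $n\ge1$, $$\hat\phi_{2n+\epsilon}(w)=\frac{(-i)^{\epsilon}(n-1)!}{(n-\frac12+\epsilon)_{n+1}}\cos\!\left(w-\epsilon\tfrac{\pi}{2}\right)+\frac{(-1)^{n}(-i)^{\epsilon}(n-1)!}{(n-\frac12+\epsilon)_{n+1}(\frac12)_{2n+2+\epsilon}}\left(\tfrac w2\right)^{2n+2+\epsilon}{}_0F_1\!\left({-\atop 2n+\frac52+\epsilon};-\left(\tfrac w2\right)^2\right)$$ $$+\frac{(-1)^{n-1}(-i)^{\epsilon}(n-1)!\,(n+1)(n+\frac12+\epsilon)}{(n-\frac12+\epsilon)_{n+1}(\frac12)_{2n+1+\epsilon}}\left(\tfrac w2\right)^{2n+\epsilon}{}_0F_1\!\left({-\atop 2n+\frac32+\epsilon};-\left(\tfrac w2\right)^2\right);$$ (2) for $n\ge2$, $$\hat l_0^n(w)=\frac{4}{n(n+2)}e^{iw}-\frac{4(-1)^n e^{-iw}}{n(n+1)(n+2)}-\frac{4(n-1)!\,(2iw)^{n+1}e^{-iw}}{(2n+2)!}\,{}_2F_2\!\left({n+1,\ n+3\atop n+2,\ 2n+3};2iw\right)$$ $$=\frac{4}{n(n+2)}e^{iw}-\frac{4(-1)^n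 e^{-iw}}{n(n+1)(n+2)}-\frac{4(n-1)!\,(2iw)^{n+1}}{(2n+2)!}\left(\frac{iwn}{(n+2)(2n+3)}\,{}_0F_1\!\left({-\atop n+\frac52};-\left(\tfrac w2\right)^2\right)+{}_0F_1\!\left({-\atop n+\frac32};-\left(\tfrac w2\right)^2\right)\right);$$ (3) for integers $n,m\ge0$ with $2n+1+\epsilon\ge2$, $$\hat u_{m,n,\epsilon}(w)=-(-iw)^{\epsilon}\frac{(-m-\frac12)_{n+1}}{(m+\epsilon+1)_{n+2}(\frac12+\epsilon)_{2n+2}}\left(\tfrac w2\right)^{2n+2}{}_1F_2\!\left({n+m+\epsilon+2\atop n+m+\epsilon+3,\ 2n+\frac52+\epsilon};-\left(\tfrac w2\right)^2\right)$$ $$-(-iw)^{\epsilon}\frac{(-1)^n(-m-\frac12)_{n+1}}{(m+1+\epsilon)_{n+1}(n+1)(\frac12+\epsilon+n)}\,{}_0F_1\!\left({-\atop\frac12+\epsilon};-\left(\tfrac w2\right)^2\right)$$ $$-(-iw)^{\epsilon}\frac{(-m-\frac12)_{n+1}}{(n+1)(\frac12+\epsilon+n)(m+1+\epsilon)_{n+1}(\frac12+\epsilon)_{2n+2}}\left(\tfrac w2\right)^{2n+2}{}_0F_1\!\left({-\atop 2n+\frac52+\epsilon};-\left(\tfrac w2\right)^2\right).$$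
   Context: $(a)_0=1$, $(a)_j=a(a+1)\cdots(a+j-1)$; ${}_pF_q\left({a_1,\dots,a_p\atop b_1,\dots,b_q};t\right)=\sum_{i\ge0}\frac{(a_1)_i\cdots(a_p)_i}{(b_1)_i\cdots(b_q)_i\,i!}t^i$ (a dash means no upper parameters). $p_n^\lambda$ is the monic ultraspherical polynomial of degree $n$, orthogonal on $[-1,1]$ with respect to $(1-x^2)^{\lambda-1/2}$. For $j\ge2$, $\phi_j(t)=(1-t^2)\,p_{j-2}^{5/2}(t)$ on $[-1,1]$. For $N\ge2$, $P^N$ is the orthogonal projection of $L^2[-1,1]$ onto the polynomials of degree at most $N$ vanishing at $\pm1$ (spanned by $\phi_2,\dots,\phi_N$). Set $r_0^N=(I-P^N)(1+t)$ and $l_0^N(t)=r_0^N(-t)$. On $[-1,1]$ let $\bar u_M(t)=1-|t|t^{M-1}$ for odd $M\ge1$, $\bar u_M(t)=t-|t|t^{M-1}$ for even $M\ge2$, and $u_{N,N-M}=(I-P^N)\bar u_M$. *)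

(* Defs.v *)
From Stdlib Require Export Reals ZArith List ClassicalEpsilon.
From Coquelicot Require Export Coquelicot.
Export ListNotations.

#[global] Coercion INR : nat >-> R.

Open Scope R_scope.

Definition poch (a : C) : nat -> C :=
  fix poch j := match j with O => RtoC 1 | S j => (poch j * (a + j))%C end.

Definition pochs (l : list C) (j : nat) : C :=
  fold_right (fun a z => (poch a j * z)%C) (RtoC 1) l.

Definition CSeries (a : nat -> C) : C :=
  (Series (fun k => Re (a k)), Series (fun k => Im (a k))).

(* The generalized hypergeometric series with upper parameters [a] and lower
   parameters [b]; an empty list is the dash. *)
Definition pFq (a b : list C) (t : C) : C :=
  CSeries (fun k => (pochs a k / (pochs b k * fact k) * t ^ k)%C).

Definition Cexp (z : C) : C :=
  (exp (Re z) * cos (Im z), exp (Re z) * sin (Im z)).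

Definition fourier (g : R -> R) (w : R) : C :=
  RInt (V := C_R_CompleteNormedModule)
    (fun t => (Cexp (- (Ci * w * t)) * g t)%C) (-1) 1.

(* [a 0 + a 1 * t + ... + a n * t ^ n]; Coquelicot's [sum_n] has n + 1 terms. *)
Definition poly (a : nat -> R) (n : nat) (t : R) : R :=
  sum_n (fun k => a k * t ^ k) n.

Definition poly_deg_le (n : nat) (f : R -> R) : Prop :=
  exists a : nat -> R, forall t, f t = poly a n t.

Definition poly_monic (n : nat) (f : R -> R) : Prop :=
  exists a : nat -> R, a n = 1 /\ forall t, f t = poly a n t.

(* The integral is improper at both ends, since the weight is singular at the
   endpoints when [-1/2 < lam < 1/2]. *)
Definition is_ultraspherical (lam : R) (n : nat) (p : R -> R) : Prop :=
  poly_monic n p /\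
  forall (m : nat) (q : R -> R), (m < n)%nat -> poly_deg_le m q ->
    is_RInt_gen (fun x => p x * q x * Rpower (1 - x ^ 2) (lam - 1 / 2))
      (at_right (-1)) (at_left 1) 0.

(* [is_ultraspherical lam n] determines a unique function for [lam > -1/2]. *)
Definition ultraspherical (lam : R) (n : nat) : R -> R :=
  epsilon (inhabits (fun _ => 0)) (is_ultraspherical lam n).

(* Meaningful for [j >= 2]. *)
Definition phi (j : nat) (t : R) : R :=
  (1 - t ^ 2) * ultraspherical (5 / 2) (j - 2) t.

Definition poly_vanishing (N : nat) (p : R -> R) : Prop :=
  poly_deg_le N p /\ p (-1) = 0 /\ p 1 = 0.

(* [p] is in the range and [f - p] is orthogonal to it in L^2[-1,1].  The
   projection is applied below to continuous functions only, for which the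
   L^2 inner product is a Riemann integral. *)
Definition is_proj (N : nat) (f p : R -> R) : Prop :=
  poly_vanishing N p /\
  forall q, poly_vanishing N q ->
    is_RInt (fun t => (f t - p t) * q t) (-1) 1 0.

Definition proj (N : nat) (f : R -> R) : R -> R :=
  epsilon (inhabits (fun _ => 0)) (is_proj N f).

Definition r0 (N : nat) (t : R) : R :=
  (1 + t) - proj N (fun s => 1 + s) t.

Definition l0 (N : nat) (t : R) : R := r0 N (- t).

Definition ubar (M : nat) (t : R) : R :=
  (if Nat.even M then t else 1) - Rabs t * t ^ (M - 1).

(* [u N k] is u_{N,k}, so that M = N - k; the index k may be negative. *)
Definition u (N : nat) (k : Z) (t : R) : R :=
  let M := Z.to_nat (Z.of_nat N - k) in
  ubar M t - proj N (ubar M) t.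

(* Main.v *)
Require Import Defs.
From Stdlib Require Import Lra Lia.

(* Each function [g] involved is determined by its moments, and its Fourier
   transform is the power series [sum_k (-iw)^k / k! * m_k].  The function [phi_j] is
   orthogonal to [(1 - t^2) q] for [deg q < j - 2], and [g = (I - P^N) f] is for
   [deg q <= N - 2], so the moments of low order and given parity are all equal to a
   constant, which produces the elementary terms; the full moment is a rational
   function of its order, of the form constant * (1 - product vanishing at the low
   orders), and the shifted tail of that product produces the hypergeometric series.
   The moments of [phi_j] follow from the three-term recurrence of [p_n^{5/2}]; those
   of the residuals follow by subtracting the components along [phi_2, phi_3, ...] one
   at a time.  The first form of the transform of [l_0^n] comes in the same way from
   the moments about the endpoint [-1], the second one from those about [0]. *)

Open Scope R_scope.

(** * Moments *)

(** No norm and no inner product of two basis functions is computed. The residuals are written down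
    with explicit coefficients and recognised afterwards: if the moments of [g] of order [k <= N]
    are [a + b * (-1) ^ k], then integrating a polynomial [q] of degree at most [N] against [g]
    gives [a * q 1 + b * q (-1)], which is zero when [q] vanishes at both ends. Accordingly, the
    multiple of [psi n] to subtract is the one that moves the constant of the low moments to the
    constant of the next residual. A claim about the low moments alone would not be inductive: the
    recurrence refers to a moment one order higher, and each subtraction has to bring one more
    moment to the common value. The inductions therefore carry moments of all orders as rational
    functions of the order, and each step becomes a rational identity. The polynomials and the
    projections are chosen by [epsilon], so they can be reached only through uniqueness; agreement
    on the open interval is enough under the integral. *)

Definition mom (h f : R -> R) (v : R) : Prop :=
  is_RInt (fun t => h t * f t) (-1) 1 v.

Lemma mom_ext (h f g : R -> R) v :
  (forall t, -1 < t < 1 -> f t = g t) -> mom h f v -> mom h g v.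
Proof.
  intros E; apply is_RInt_ext; intros t.
  rewrite Rmin_left, Rmax_right by lra; intros Ht.
  now rewrite E.
Qed.

Lemma mom_lin (h f g : R -> R) a b c d :
  mom h f a -> mom h g b -> mom h (fun t => c * f t + d * g t) (c * a + d * b).
Proof.
  intros Hf Hg.
  apply is_RInt_ext with (fun t => plus (scal c (h t * f t)) (scal d (h t * g t))).
  { intros t _; unfold plus, scal; simpl; unfold mult; simpl; ring. }
  apply (is_RInt_plus (V := R_NormedModule)); apply (is_RInt_scal (V := R_NormedModule)); assumption.
Qed.

Lemma is_RInt_pow (k : nat) (a b : R) :
  is_RInt (fun t => t ^ k) a b ((b ^ S k - a ^ S k) / (k + 1)).
Proof.
  replace ((b ^ S k - a ^ S k) / (k + 1))
    with (minus (b ^ S k / (k + 1)) (a ^ S k / (k + 1)))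
    by (unfold minus, plus, opp; simpl; pose proof (pos_INR k); field; lra).
  apply (is_RInt_derive (fun t => t ^ S k / (k + 1))).
  - intros t _. auto_derive; [trivial|].
    pose proof (pos_INR k).
    change (1 * (INR (S k) * t ^ k) * / (k + 1) = t ^ k).
    rewrite S_INR. field; lra.
  - intros t _. apply (ex_derive_continuous (fun t => t ^ k)). auto_derive; trivial.
Qed.

Lemma is_RInt_odd (f : R -> R) v :
  (forall t, f (- t) = - f t) -> is_RInt f (-1) 1 v -> v = 0.
Proof.
  intros O H.
  pose proof (is_RInt_comp_opp (V := R_NormedModule) f 1 (-1) v) as H1.
  replace (- (-1)) with 1 in H1 by ring. replace (- (1)) with (-1) in H1 by ring.
  specialize (H1 H).
  apply is_RInt_swap in H1.
  assert (E : is_RInt f (-1) 1 (opp v)).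
  { apply is_RInt_ext with (2 := H1). intros t _. rewrite O. unfold opp; simpl; ring. }
  pose proof (is_RInt_unique _ _ _ _ E) as E1.
  rewrite (is_RInt_unique _ _ _ _ H) in E1. unfold opp in E1; simpl in E1. lra.
Qed.

Lemma is_RInt_even (f : R -> R) v :
  (forall t, f (- t) = f t) -> is_RInt f 0 1 v -> is_RInt f (-1) 1 (2 * v).
Proof.
  intros O H.
  replace (2 * v) with (plus v v) by (unfold plus; simpl; ring).
  apply (is_RInt_Chasles (V := R_NormedModule)) with 0; [|exact H].
  pose proof (is_RInt_comp_opp (V := R_NormedModule) f 0 (-1) v) as H1.
  replace (- (-1)) with 1 in H1 by ring. rewrite Ropp_0 in H1. specialize (H1 H).
  apply is_RInt_swap in H1.
  replace v with (opp (opp v)) by (unfold opp; simpl; ring).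
  apply is_RInt_ext with (fun t => opp (opp (f (- t)))).
  { intros t _. rewrite O. unfold opp; simpl; ring. }
  apply (is_RInt_opp (V := R_NormedModule)). exact H1.
Qed.

(* The monic ultraspherical polynomial p_n^{5/2}; the ratio is n(n+4)/((2n+3)(2n+5))
   at n = k + 1. *)
Fixpoint gegen (n : nat) (t : R) : R :=
  match n with
  | O => 1
  | S m =>
      match m with
      | O => t
      | S k => t * gegen m t - (k + 1) * (k + 5) / ((2 * k + 7) * (2 * k + 5)) * gegen k t
      end
  end.

(* [psi n] is phi_{n+2}. *)
Definition psi (n : nat) (t : R) : R := (1 - t ^ 2) * gegen n t.

(* The common value of the moments of [psi n] of the parity of [n] and order at most
   [n + 1]. *)
Fixpoint psi_const (n : nat) : R :=
  match n with O => 4 / 3 | S n => psi_const n * ((n + 1) / (2 * n + 5)) end.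

(* Vanishes at j = 0, ..., n - 1, where j encodes the moment order 2j + e. *)
Fixpoint zprod (e j : R) (n : nat) : R :=
  match n with O => 1 | S n => zprod e j n * ((j - n) / (j + n + 1 / 2 + e)) end.

(* The moment of order 2j + e of [psi (2 * n + e)], for e = 0, 1. *)
Definition psi_moment (e : nat) (n j : nat) : R :=
  psi_const (2 * n + e) * (1 - zprod e j (S n) * ((j - (n + 1) + (n + 2) * (n + 3 / 2 + e)) / (j + n + 3 / 2 + e))).

Lemma gegen_SS (k : nat) (t : R) :
  gegen (S (S k)) t
  = t * gegen (S k) t - (k + 1) * (k + 5) / ((2 * k + 7) * (2 * k + 5)) * gegen k t.
Proof. reflexivity. Qed.

Lemma psi_const_S (n : nat) : psi_const (S n) = psi_const n * ((n + 1) / (2 * n + 5)).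
Proof. reflexivity. Qed.

Lemma zprod_S e j (n : nat) : zprod e j (S n) = zprod e j n * ((j - n) / (j + n + 1 / 2 + e)).
Proof. reflexivity. Qed.

Ltac posnat := repeat match goal with
  | n : nat |- _ => lazymatch goal with H : 0 <= INR n |- _ => fail | _ => pose proof (pos_INR n) end
  end.

(** The numerators agree and the denominators are offset by one, so the quotient telescopes. The
    recurrence mixes both parities, hence this lemma and the next. *)
Lemma zprod_1_0 (j : R) (n : nat) : 0 <= j -> zprod 1 j n = zprod 0 j n * ((j + 1 / 2) / (j + n + 1 / 2)).
Proof.
  intros Hj; induction n as [|n IH].
  - simpl. field. lra.
  - rewrite !zprod_S, IH, S_INR. posnat. field. lra.
Qed.

(** Multiplying [t ^ (2 * j + 1)] by [t] gives the even order [2 * (j + 1)]; the runs of factors on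
    both sides then overlap up to one end factor each. *)
Lemma zprod_shift (j : R) (n : nat) : 0 <= j -> zprod 0 (j + 1) (S n) = (j + 1) / (j + n + 3 / 2) * zprod 1 j n.
Proof.
  intros Hj; induction n as [|n IH].
  - simpl. field. lra.
  - rewrite zprod_S, IH, zprod_S, S_INR. posnat. field. lra.
Qed.

Lemma mom_weight (h g f : R -> R) v : (forall t, h t = g t) -> mom h f v -> mom g f v.
Proof. intros E; apply is_RInt_ext; intros t _; now rewrite E. Qed.

Lemma mom_conv (h g f k : R -> R) v : (forall t, h t * f t = g t * k t) -> mom h f v -> mom g k v.
Proof. intros E; apply is_RInt_ext; intros t _; apply E. Qed.

(** The factor [t] of the three-term recurrence is moved from the polynomial to the weight. *)
Lemma mom_psi_SS (h : R -> R) (k : nat) a b :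
  mom (fun t => t * h t) (psi (S k)) a -> mom h (psi k) b ->
  mom h (psi (S (S k))) (a - (k + 1) * (k + 5) / ((2 * k + 7) * (2 * k + 5)) * b).
Proof.
  intros Ha Hb.
  set (c := (k + 1) * (k + 5) / ((2 * k + 7) * (2 * k + 5))).
  replace (a - c * b) with (1 * a + - c * b) by ring.
  apply mom_ext with (fun t => 1 * (t * psi (S k) t) + - c * psi k t).
  { intros t _. unfold psi. rewrite gegen_SS. fold c. ring. }
  apply mom_lin; [|exact Hb].
  apply mom_conv with (2 := Ha). intros t. ring.
Qed.

Lemma mom_poly0 (k : nat) : mom (fun t => t ^ k) (fun _ => 1) ((1 - (-1) ^ S k) / (k + 1)).
Proof.
  pose proof (is_RInt_pow k (-1) 1) as H. rewrite pow1 in H.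
  refine (is_RInt_ext _ _ _ _ _ _ H). intros t _. symmetry. apply Rmult_1_r.
Qed.

Lemma mom_shift (k l : nat) f v : mom (fun t => t ^ (k + l)) f v ->
  mom (fun t => t ^ k) (fun t => t ^ l * f t) v.
Proof.
  intros H; apply mom_conv with (2 := H). intros t. rewrite pow_add. ring.
Qed.

Lemma pow_m1_even (k : nat) : (-1) ^ (2 * k) = 1.
Proof. rewrite pow_mult. replace ((-1) ^ 2) with 1 by ring. apply pow1. Qed.

Lemma mom_psi_0 (k : nat) : mom (fun t => t ^ k) (psi 0)
  ((1 - (-1) ^ S k) / (k + 1) - (1 - (-1) ^ S k) / (k + 3)).
Proof.
  pose proof (mom_poly0 k) as H0. pose proof (mom_shift k 2 _ _ (mom_poly0 (k + 2))) as H2.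
  pose proof (mom_lin _ _ _ _ _ 1 (-1) H0 H2) as H.
  replace (_ - _) with (1 * ((1 - (-1) ^ S k) / (k + 1)) +
     -1 * ((1 - (-1) ^ S (k + 2)) / ((k + 2)%nat + 1))).
  - eapply mom_ext; [|exact H]. intros t _. unfold psi; simpl. ring.
  - replace (S (k + 2)) with (2 * 1 + S k)%nat by lia. rewrite pow_add, pow_m1_even.
    rewrite plus_INR. posnat. simpl (INR 2). field. lra.
Qed.

Lemma mom_psi_1 (k : nat) : mom (fun t => t ^ k) (psi 1)
  ((1 - (-1) ^ k) / (k + 2) - (1 - (-1) ^ k) / (k + 4)).
Proof.
  pose proof (mom_psi_0 (S k)) as H.
  replace (S (S k)) with (2 * 1 + k)%nat in H by lia.
  rewrite pow_add, pow_m1_even, Rmult_1_l, S_INR in H.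
  replace (k + 1 + 1) with (k + 2) in H by ring. replace (k + 1 + 3) with (k + 4) in H by ring.
  apply mom_conv with (2 := H). intros t. unfold psi; simpl. ring.
Qed.

(** The four families are proved together because the recurrence feeds the moments of one parity of
    [psi (2 * n + 1)] into those of the other parity of [psi (2 * n + 2)]; [j] is quantified inside
    because the order rises. *)
Lemma psi_moments (n : nat) : forall j : nat,
  mom (fun t => t ^ (2 * j)) (psi (2 * n)) (psi_moment 0 n j) /\
  mom (fun t => t ^ (2 * j + 1)) (psi (2 * n)) 0 /\
  mom (fun t => t ^ (2 * j + 1)) (psi (2 * n + 1)) (psi_moment 1 n j) /\
  mom (fun t => t ^ (2 * j)) (psi (2 * n + 1)) 0.
Proof.
  induction n as [|n IH]; intros j.
  - repeat split.
    + pose proof (mom_psi_0 (2 * j)) as H. unfold psi_moment.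
      change ((-1) ^ S (2 * j)) with (-1 * (-1) ^ (2 * j)) in H. rewrite pow_m1_even, mult_INR in H.
      replace (psi_const _ * _) with ((1 - -1 * 1) / (INR 2 * j + 1) - (1 - -1 * 1) / (INR 2 * j + 3)); [exact H|].
      simpl. posnat. field. lra.
    + pose proof (mom_psi_0 (2 * j + 1)) as H.
      change ((-1) ^ S (2 * j + 1)) with (-1 * (-1) ^ (2 * j + 1)) in H.
      rewrite pow_add, pow_m1_even in H.
      replace 0 with ((1 - -1 * (1 * (-1) ^ 1)) / ((2 * j + 1)%nat + 1) -
       (1 - -1 * (1 * (-1) ^ 1)) / ((2 * j + 1)%nat + 3)); [exact H|].
      posnat. field. split; apply Rgt_not_eq; pose proof (pos_INR (2 * j + 1)); lra.
    + pose proof (mom_psi_1 (2 * j + 1)) as H. unfold psi_moment.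
      rewrite pow_add, pow_m1_even, plus_INR, mult_INR in H.
      match type of H with mom _ _ ?v => replace (psi_const _ * _) with v; [exact H|] end.
      simpl. posnat. field. lra.
    + pose proof (mom_psi_1 (2 * j)) as H.
      rewrite pow_m1_even in H.
      match type of H with mom _ _ ?v => replace 0 with v; [exact H|] end.
      unfold Rdiv. ring.
  (* [psi (2 * n + 2)] is settled for every order first, since [psi (2 * n + 3)] at index [j] needs
     its moment at index [j + 1]. *)
  - assert (E1 : forall j, mom (fun t => t ^ (2 * j)) (psi (2 * S n)) (psi_moment 0 (S n) j)).
    { intros i. destruct (IH i) as (H0 & _ & H1 & _).
      replace (2 * S n)%nat with (S (S (2 * n))) by lia.
      replace (2 * n + 1)%nat with (S (2 * n)) in H1 by lia.
      assert (H2 : mom (fun t => t * t ^ (2 * i)) (psi (S (2 * n))) (psi_moment 1 n i)).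
      { eapply mom_weight; [|exact H1]. intros t; simpl. rewrite pow_add. ring. }
      pose proof (mom_psi_SS _ _ _ _ H2 H0) as H.
      match type of H with mom _ _ ?v => replace (psi_moment 0 (S n) i) with v; [exact H|] end.
      unfold psi_moment. replace (2 * S n + 0)%nat with (S (S (2 * n))) by lia.
      replace (2 * n + 0)%nat with (2 * n)%nat by lia. replace (2 * n + 1)%nat with (S (2 * n)) by lia.
      rewrite !psi_const_S, (zprod_S 0%nat i (S n)). change (INR 1) with 1. change (INR 0) with 0.
      rewrite zprod_1_0 by apply pos_INR. rewrite !S_INR, mult_INR. change (INR 2) with 2.
      posnat. field. lra. }
    assert (E2 : forall j, mom (fun t => t ^ (2 * j + 1)) (psi (2 * S n)) 0).
    { intros i. destruct (IH i) as (_ & H0 & _). destruct (IH (S i)) as (_ & _ & _ & H1).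
      replace (2 * S n)%nat with (S (S (2 * n))) by lia.
      replace (2 * n + 1)%nat with (S (2 * n)) in H1 by lia.
      assert (H2 : mom (fun t => t * t ^ (2 * i + 1)) (psi (S (2 * n))) 0).
      { eapply mom_weight; [|exact H1]. intros t. replace (2 * S i)%nat with (S (2 * i + 1)) by lia. reflexivity. }
      pose proof (mom_psi_SS _ _ _ _ H2 H0) as H.
      rewrite Rmult_0_r, Rminus_0_r in H. exact H. }
    repeat split; [apply E1 | apply E2 | |].
    + destruct (IH j) as (_ & _ & H0 & _). pose proof (E1 (S j)) as H1.
      replace (2 * S n + 1)%nat with (S (S (2 * n + 1))) by lia.
      replace (2 * S n)%nat with (S (2 * n + 1)) in H1 by lia.
      assert (H2 : mom (fun t => t * t ^ (2 * j + 1)) (psi (S (2 * n + 1))) (psi_moment 0 (S n) (S j))).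
      { eapply mom_weight; [|exact H1]. intros t. replace (2 * S j)%nat with (S (2 * j + 1)) by lia. reflexivity. }
      pose proof (mom_psi_SS _ _ _ _ H2 H0) as H.
      match type of H with mom _ _ ?v => replace (psi_moment 1 (S n) j) with v; [exact H|] end.
      unfold psi_moment. replace (2 * S n + 1)%nat with (S (S (2 * n + 1))) by lia.
      replace (2 * S n + 0)%nat with (S (2 * n + 1)) by lia.
      rewrite !psi_const_S, (zprod_S 1%nat j (S n)). change (INR 1) with 1. change (INR 0) with 0.
      rewrite (S_INR j), zprod_shift by apply pos_INR. rewrite !S_INR, plus_INR, mult_INR. change (INR 2) with 2.
      change (INR 1) with 1.
      posnat. field. lra.
    + destruct (IH j) as (_ & _ & _ & H0). pose proof (E2 j) as H1.
      replace (2 * S n + 1)%nat with (S (S (2 * n + 1))) by lia.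
      replace (2 * S n)%nat with (S (2 * n + 1)) in H1 by lia.
      assert (H2 : mom (fun t => t * t ^ (2 * j)) (psi (S (2 * n + 1))) 0).
      { eapply mom_weight; [|exact H1]. intros t; simpl. rewrite pow_add. ring. }
      pose proof (mom_psi_SS _ _ _ _ H2 H0) as H.
      rewrite Rmult_0_r, Rminus_0_r in H. exact H.
Qed.

(* The counterpart of [zprod] for moments about -1. *)
Fixpoint uprod (s : R) (n : nat) : R :=
  match n with O => 1 | S n => uprod s n * ((s - (n + 1)) / (s + n + 2)) end.

Lemma uprod_S s (n : nat) : uprod s (S n) = uprod s n * ((s - (n + 1)) / (s + n + 2)).
Proof. reflexivity. Qed.

(** Both numerators and denominators are runs of consecutive numbers; moving each run by one changes
    only its end factors. *)
Lemma uprod_shift (s : R) (n : nat) : 0 <= s ->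
  uprod (s + 1) (S n) = s * (s + 2) / ((s + n + 2) * (s + n + 3)) * uprod s n.
Proof.
  intros Hs; induction n as [|n IH].
  - simpl. field. lra.
  - rewrite uprod_S, IH, uprod_S, S_INR. posnat. field. lra.
Qed.

Lemma mom_shifted_pow (k l : nat) :
  mom (fun t => (1 + t) ^ k) (fun t => (1 + t) ^ l) (2 * 2 ^ (k + l) / ((k + l)%nat + 1)).
Proof.
  assert (B : forall i : nat, mom (fun t => (1 + t) ^ i) (fun _ => 1) (2 * 2 ^ i / (i + 1))).
  { intros i. unfold mom. pose proof (is_RInt_pow i 0 2) as H.
    pose proof (is_RInt_comp_lin (V := R_NormedModule) (fun t => t ^ i) 1 1 (-1) 1) as HL.
    replace (1 * -1 + 1) with 0 in HL by ring. replace (1 * 1 + 1) with 2 in HL by ring.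
    specialize (HL _ H). rewrite pow_i, Rminus_0_r in HL by lia.
    refine (is_RInt_ext _ _ _ _ _ _ HL). intros t _. unfold scal; simpl; unfold mult; simpl.
    rewrite (Rplus_comm _ 1), !Rmult_1_l, Rmult_1_r. reflexivity. }
  refine (mom_conv _ _ _ _ _ _ (B (k + l)%nat)). intros t. rewrite pow_add. ring.
Qed.

(** For [1 <= s <= n + 1] the product [uprod s (S n)] vanishes, and what remains is
    [psi_const n / 2] times the value of [(1 + t) ^ s] at the endpoint 1, its value at -1 being
    zero. *)
Lemma mom_psi_shifted (n s : nat) :
  mom (fun t => (1 + t) ^ s) (psi n)
    (2 ^ s / 2 * psi_const n * (1 - uprod s (S n) * ((s + (n + 2) * (n + 3)) / (s + n + 3)))).
Proof.
  assert (H0 : forall s : nat, mom (fun t => (1 + t) ^ s) (psi 0)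
    (2 ^ s / 2 * psi_const 0 * (1 - uprod s 1 * ((s + (0%nat + 2) * (0%nat + 3)) / (s + 0%nat + 3))))).
  { intros i. pose proof (mom_lin _ _ _ _ _ 2 (-1) (mom_shifted_pow i 1%nat) (mom_shifted_pow i 2%nat)) as H.
    match type of H with mom _ _ ?v => match goal with |- mom _ _ ?w => replace w with v end end.
    - refine (mom_conv _ _ _ _ _ _ H). intros t. unfold psi; simpl. ring.
    - rewrite !pow_add, !plus_INR. simpl. posnat. field. lra. }
  assert (H1 : forall s : nat, mom (fun t => (1 + t) ^ s) (psi 1)
    (2 ^ s / 2 * psi_const 1 * (1 - uprod s 2 * ((s + (1%nat + 2) * (1%nat + 3)) / (s + 1%nat + 3))))).
  { intros i.
    (* The coefficients -2, 3, -1 expand [(1 - t ^ 2) * t] in powers of [1 + t]; the final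
       coefficient 0 is a filler. *)
    pose proof (mom_lin _ _ _ _ _ 1 1 (mom_lin _ _ _ _ _ (-2) 3 (mom_shifted_pow i 1%nat) (mom_shifted_pow i 2%nat))
      (mom_lin _ _ _ _ _ (-1) 0 (mom_shifted_pow i 3%nat) (mom_shifted_pow i 3%nat))) as H.
    match type of H with mom _ _ ?v => match goal with |- mom _ _ ?w => replace w with v end end.
    - refine (mom_conv _ _ _ _ _ _ H). intros t. unfold psi; simpl. ring.
    - rewrite !pow_add, !plus_INR. simpl. posnat. field. lra. }
  revert s. induction n as [n IH] using (well_founded_induction Wf_nat.lt_wf).
  destruct n as [|[|n]]; [exact H0 | exact H1 |]. intros s.
  pose proof (IH n ltac:(lia) s) as K0. pose proof (IH (S n) ltac:(lia) s) as K1.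
  pose proof (IH (S n) ltac:(lia) (S s)) as K2.
  (* Writing [t] as [(1 + t) - 1] turns the factor of the recurrence into a difference of the orders
     [s + 1] and [s]. *)
  assert (K3 : mom (fun t => t * (1 + t) ^ s) (psi (S n))
    (1 * (2 ^ S s / 2 * psi_const (S n) * (1 - uprod (S s) (S (S n)) * ((S s + (S n + 2) * (S n + 3)) / (S s + S n + 3))))
    + -1 * (2 ^ s / 2 * psi_const (S n) * (1 - uprod s (S (S n)) * ((s + (S n + 2) * (S n + 3)) / (s + S n + 3)))))).
  { assert (K2' : mom (fun t => (1 + t) ^ s) (fun t => (1 + t) * psi (S n) t)
     (2 ^ S s / 2 * psi_const (S n) * (1 - uprod (S s) (S (S n)) * ((S s + (S n + 2) * (S n + 3)) / (S s + S n + 3))))).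
    { refine (mom_conv _ _ _ _ _ _ K2). intros t. simpl. ring. }
    refine (mom_conv _ _ _ _ _ _ (mom_lin _ _ _ _ _ 1 (-1) K2' K1)). intros t. simpl. ring. }
  pose proof (mom_psi_SS _ _ _ _ K3 K0) as H.
  match type of H with mom _ _ ?v => match goal with |- mom _ _ ?w => replace w with v; [exact H|] end end.
  rewrite (S_INR s), uprod_shift by apply pos_INR. rewrite !uprod_S, !psi_const_S, !S_INR. simpl (2 ^ S s).
  posnat. field. lra.
Qed.

(** * Moments of the residuals of [1 + t] *)

Lemma psi_const_pos (n : nat) : 0 < psi_const n.
Proof.
  induction n as [|n IH]; [simpl; lra|]. rewrite psi_const_S. posnat.
  apply Rmult_lt_0_compat; [exact IH|]. apply Rdiv_lt_0_compat; lra.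
Qed.

(* [r0_res n] is r_0^{n+1}. *)
Fixpoint r0_res (n : nat) (t : R) : R :=
  match n with
  | O => 1 + t
  | S n => r0_res n t - 8 / psi_const n * (1 / ((n + 1) * (n + 3)) - 1 / ((n + 2) * (n + 4))) * psi n t
  end.

(** Here [n] counts the subtracted functions of parity [e] and is not the index of the residual:
    each subtraction affects the moments of one parity only. *)
Definition r0_moment (e : R) (n j : nat) : R :=
  / ((n + 1) * (n + 1 / 2 + e)) * (1 - zprod e j (S n)).

Lemma mom_r0_res_S (h : R -> R) (n : nat) a b :
  mom h (r0_res n) a -> mom h (psi n) b ->
  mom h (r0_res (S n)) (a - 8 / psi_const n * (1 / ((n + 1) * (n + 3)) - 1 / ((n + 2) * (n + 4))) * b).
Proof.
  intros Ha Hb.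
  pose proof (mom_lin _ _ _ _ _ 1 (- (8 / psi_const n * (1 / ((n + 1) * (n + 3)) - 1 / ((n + 2) * (n + 4))))) Ha Hb) as H.
  match type of H with mom _ _ ?v => match goal with |- mom _ _ ?w => replace w with v by ring end end.
  refine (mom_conv _ _ _ _ _ _ H). intros t. simpl. ring.
Qed.

(** This explains the coefficient in [r0_res]: the low moments have to drop from
    [2 ^ s * 4 / ((n + 1) * (n + 3))] to the same expression at [n + 1], while those of [psi n] are
    [2 ^ s / 2 * psi_const n]. *)
Lemma mom_r0_res_shifted (n s : nat) :
  mom (fun t => (1 + t) ^ s) (r0_res n) (2 ^ s * (4 / ((n + 1) * (n + 3))) * (1 - uprod s (S n))).
Proof.
  induction n as [|n IH].
  - pose proof (mom_shifted_pow s 1) as H.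
    match type of H with mom _ _ ?v => match goal with |- mom _ _ ?w => replace w with v end end.
    + refine (mom_conv _ _ _ _ _ _ H). intros t. simpl. ring.
    + rewrite pow_add, plus_INR. simpl. posnat. field. lra.
  - pose proof (mom_r0_res_S _ _ _ _ IH (mom_psi_shifted n s)) as H.
    match type of H with mom _ _ ?v => match goal with |- mom _ _ ?w => replace w with v; [exact H|] end end.
    rewrite !uprod_S, !S_INR. pose proof (psi_const_pos n). posnat. field. lra.
Qed.

Lemma mom_pow (k l : nat) :
  mom (fun t => t ^ k) (fun t => t ^ l) ((1 - (-1) ^ S (k + l)) / ((k + l)%nat + 1)).
Proof.
  refine (mom_conv _ _ _ _ _ _ (mom_poly0 (k + l))). intros t. rewrite pow_add. ring.
Qed.

Lemma r0_res_moments (n : nat) : forall j : nat,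
  (mom (fun t => t ^ (2 * j)) (r0_res (2 * n)) (r0_moment 0 n j) /\
   mom (fun t => t ^ (2 * j + 1)) (r0_res (2 * n)) (r0_moment 1 n j)) /\
  (mom (fun t => t ^ (2 * j)) (r0_res (2 * n + 1)) (r0_moment 0 (S n) j) /\
   mom (fun t => t ^ (2 * j + 1)) (r0_res (2 * n + 1)) (r0_moment 1 n j)).
Proof.
  (* One round subtracts a multiple of [psi (2 * n)], which changes the even moments only, and then
     one of [psi (2 * n + 1)], which changes the odd ones only. *)
  assert (St : forall n j, mom (fun t => t ^ (2 * j)) (r0_res (2 * n)) (r0_moment 0 n j) /\
     mom (fun t => t ^ (2 * j + 1)) (r0_res (2 * n)) (r0_moment 1 n j) ->
   (mom (fun t => t ^ (2 * j)) (r0_res (2 * n + 1)) (r0_moment 0 (S n) j) /\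
    mom (fun t => t ^ (2 * j + 1)) (r0_res (2 * n + 1)) (r0_moment 1 n j)) /\
   (mom (fun t => t ^ (2 * j)) (r0_res (2 * S n)) (r0_moment 0 (S n) j) /\
    mom (fun t => t ^ (2 * j + 1)) (r0_res (2 * S n)) (r0_moment 1 (S n) j))).
  { clear n. intros n j [H0 H1]. destruct (psi_moments n j) as (K0 & K1 & K2 & K3).
    replace (2 * S n)%nat with (S (2 * n + 1)) by lia.
    assert (G0 : mom (fun t => t ^ (2 * j)) (r0_res (2 * n + 1)) (r0_moment 0 (S n) j)).
    { replace (2 * n + 1)%nat with (S (2 * n)) by lia.
      pose proof (mom_r0_res_S _ _ _ _ H0 K0) as H.
      match type of H with mom _ _ ?v => match goal with |- mom _ _ ?w => replace w with v; [exact H|] end end.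
      unfold r0_moment, psi_moment. change (INR 0) with 0. replace (2 * n + 0)%nat with (2 * n)%nat by lia.
      rewrite (zprod_S _ _ (S n)), !S_INR, mult_INR. change (INR 2) with 2.
      pose proof (psi_const_pos (2 * n)). posnat. field. lra. }
    assert (G1 : mom (fun t => t ^ (2 * j + 1)) (r0_res (2 * n + 1)) (r0_moment 1 n j)).
    { replace (2 * n + 1)%nat with (S (2 * n)) by lia.
      pose proof (mom_r0_res_S _ _ _ _ H1 K1) as H.
      rewrite Rmult_0_r, Rminus_0_r in H. exact H. }
    repeat split; [exact G0 | exact G1 | |].
    - pose proof (mom_r0_res_S _ _ _ _ G0 K3) as H.
      rewrite Rmult_0_r, Rminus_0_r in H. exact H.
    - pose proof (mom_r0_res_S _ _ _ _ G1 K2) as H.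
      match type of H with mom _ _ ?v => match goal with |- mom _ _ ?w => replace w with v; [exact H|] end end.
      unfold r0_moment, psi_moment. change (INR 1) with 1.
      rewrite (zprod_S _ _ (S n)), !S_INR, plus_INR, mult_INR. change (INR 2) with 2. change (INR 1) with 1.
      pose proof (psi_const_pos (2 * n + 1)). posnat. field. lra. }
  intros j. enough (H : mom (fun t => t ^ (2 * j)) (r0_res (2 * n)) (r0_moment 0 n j) /\
     mom (fun t => t ^ (2 * j + 1)) (r0_res (2 * n)) (r0_moment 1 n j)).
  { split; [exact H | apply (St n j H)]. }
  induction n as [|n IH]; [|apply (St n j IH)].
  split.
  - pose proof (mom_lin _ _ _ _ _ 1 1 (mom_pow (2 * j) 0) (mom_pow (2 * j) 1)) as H.
    match type of H with mom _ _ ?v => match goal with |- mom _ _ ?w => replace w with v end end.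
    + refine (mom_conv _ _ _ _ _ _ H). intros t. simpl. ring.
    + rewrite <- !tech_pow_Rmult, !pow_add, !pow_m1_even, !plus_INR, mult_INR. unfold r0_moment. simpl. posnat. field. lra.
  - pose proof (mom_lin _ _ _ _ _ 1 1 (mom_pow (2 * j + 1) 0) (mom_pow (2 * j + 1) 1)) as H.
    match type of H with mom _ _ ?v => match goal with |- mom _ _ ?w => replace w with v end end.
    + refine (mom_conv _ _ _ _ _ _ H). intros t. simpl. ring.
    + rewrite <- !tech_pow_Rmult, !pow_add, !pow_m1_even, !plus_INR, mult_INR. unfold r0_moment. simpl. posnat. field. lra.
Qed.

(** * Moments of the residuals of [ubar] *)

(** The common value of the moments of [u_res e m n] of order [2 * j + e] with [j <= n]. The ratio
    of successive values is forced by requiring that the subtraction brings the moment with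
    [j = n + 1] to the new common value as well. *)
Fixpoint u_const (e m : R) (n : nat) : R :=
  match n with
  | O => (m + 1 / 2) / ((m + 1 + e) * (1 / 2 + e))
  | S n => u_const e m n * - ((n + 1 / 2 - m) * (n + 1) * (n + 1 / 2 + e) /
                          ((m + 2 + e + n) * (n + 2) * (n + 3 / 2 + e)))
  end.

(** The term [1 / (j + m + 1 + e)] is the moment of [Rabs t * t ^ (2 * m + e)]. Subtracting
    multiples of the [psi] never cancels this pole, and it is the source of the 1F2. *)
Definition u_moment (e m n j : nat) : R :=
  u_const e m n * (1 - zprod e j (S n) * (1 + (n + 1) * (n + 1 / 2 + e) / (j + m + 1 + e))).

(* [u_res e m n] is u_{2n+1+e, 2n-2m}. *)
Fixpoint u_res (e m n : nat) (t : R) : R :=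
  match n with
  | O => ubar (2 * m + 1 + e) t
  | S n => u_res e m n t - (u_const e m n - u_const e m (S n)) / psi_const (2 * n + e) * psi (2 * n + e) t
  end.

Lemma mom_u_res_S (e m n : nat) (h : R -> R) a b :
  mom h (u_res e m n) a -> mom h (psi (2 * n + e)) b ->
  mom h (u_res e m (S n)) (a - (u_const e m n - u_const e m (S n)) / psi_const (2 * n + e) * b).
Proof.
  intros Ha Hb.
  pose proof (mom_lin _ _ _ _ _ 1 (- ((u_const e m n - u_const e m (S n)) / psi_const (2 * n + e))) Ha Hb) as H.
  match type of H with mom _ _ ?v => match goal with |- mom _ _ ?w => replace w with v by ring end end.
  refine (mom_conv _ _ _ _ _ _ H). intros t. cbn [u_res]. ring.
Qed.

Lemma ubar_eq (e m : nat) t : (e = 0 \/ e = 1)%nat ->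
  ubar (2 * m + 1 + e) t = t ^ e - Rabs t * t ^ (2 * m + e).
Proof.
  intros He. unfold ubar. replace (2 * m + 1 + e - 1)%nat with (2 * m + e)%nat by lia.
  f_equal. replace (2 * m + 1 + e)%nat with (1 + e + 2 * m)%nat by lia.
  destruct He as [-> | ->]; rewrite Nat.even_add_mul_2; simpl; ring.
Qed.

Lemma continuous_ubar (e m : nat) t : (e = 0 \/ e = 1)%nat -> continuous (ubar (2 * m + 1 + e)) t.
Proof.
  intros He.
  apply continuous_ext with (fun t => t ^ e - Rabs t * t ^ (2 * m + e)).
  { intros x. symmetry. now apply ubar_eq. }
  apply (continuous_minus (fun t => t ^ e) (fun t => Rabs t * t ^ (2 * m + e))).
  - apply (ex_derive_continuous (fun t => t ^ e)). auto_derive; trivial.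
  - apply (continuous_mult Rabs (fun t => t ^ (2 * m + e))); [apply continuous_Rabs|].
    apply (ex_derive_continuous (fun t => t ^ (2 * m + e))). auto_derive; trivial.
Qed.

Lemma pow_m1_e2 (e : nat) : (-1) ^ e * (-1) ^ e = 1.
Proof. rewrite <- pow_add. replace (e + e)%nat with (2 * e)%nat by lia. apply pow_m1_even. Qed.

Lemma pow_opp (t : R) (k : nat) : (- t) ^ k = (-1) ^ k * t ^ k.
Proof. replace (- t) with (-1 * t) by ring. apply Rpow_mult_distr. Qed.

Lemma mom_ubar (e m j : nat) : (e = 0 \/ e = 1)%nat ->
  mom (fun t => t ^ (2 * j + e)) (ubar (2 * m + 1 + e)) (1 / (j + e + 1 / 2) - 1 / (j + m + 1 + e)) /\
  mom (fun t => t ^ (2 * j + (1 - e))) (ubar (2 * m + 1 + e)) 0.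
Proof.
  intros He. split.
  - unfold mom.
    replace (1 / _ - 1 / _) with (2 * (1 / (2 * j + 2 * e + 1) - 1 / (2 * j + 2 * m + 2 + 2 * e)))
      by (posnat; field; lra).
    apply is_RInt_even.
    { intros t. rewrite !ubar_eq, Rabs_Ropp, !(pow_opp t), !pow_add, !pow_m1_even by assumption.
      replace (_ * (_ - _)) with ((-1) ^ e * (-1) ^ e * (t ^ (2 * j) * t ^ e * (t ^ e - Rabs t * (t ^ (2 * m) * t ^ e)))) by ring.
      now rewrite pow_m1_e2, Rmult_1_l. }
    pose proof (is_RInt_pow (2 * j + e + e) 0 1) as H1.
    pose proof (is_RInt_pow (2 * j + e + (2 * m + e) + 1) 0 1) as H2.
    pose proof (is_RInt_minus (V := R_NormedModule) _ _ _ _ _ _ H1 H2) as H.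
    replace (1 / _ - 1 / _) with (minus ((1 ^ S (2 * j + e + e) - 0 ^ S (2 * j + e + e)) / ((2 * j + e + e)%nat + 1))
     ((1 ^ S (2 * j + e + (2 * m + e) + 1) - 0 ^ S (2 * j + e + (2 * m + e) + 1)) /
      ((2 * j + e + (2 * m + e) + 1)%nat + 1))).
    2: { match goal with |- minus ?x ?y = _ => change (minus x y) with (x - y) end. rewrite !pow1, !pow_i, !plus_INR, !mult_INR by lia.
         simpl. posnat. field. lra. }
    refine (is_RInt_ext _ _ _ _ _ _ H). rewrite Rmin_left, Rmax_right by lra. intros t Ht.
    rewrite ubar_eq, Rabs_pos_eq by (assumption || lra). rewrite !pow_add. unfold minus, plus, opp; simpl. ring.
  (* Oddness only identifies the value of an integral that exists; existence comes from
     continuity. *)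
  - assert (Hex : ex_RInt (fun t => t ^ (2 * j + (1 - e)) * ubar (2 * m + 1 + e) t) (-1) 1).
    { apply (ex_RInt_continuous (V := R_CompleteNormedModule)). intros t _.
      apply (continuous_mult (fun t => t ^ (2 * j + (1 - e))) (ubar (2 * m + 1 + e))).
      - apply (ex_derive_continuous (fun t => t ^ (2 * j + (1 - e)))). auto_derive; trivial.
      - now apply continuous_ubar. }
    destruct Hex as [v Hv]. enough (v = 0) as <- by exact Hv. apply (is_RInt_odd _ v) with (2 := Hv).
    intros t. rewrite !ubar_eq, Rabs_Ropp, !(pow_opp t), !pow_add, !pow_m1_even by assumption.
    destruct He as [-> | ->]; simpl; ring.
Qed.

Lemma u_res_moments (e m n j : nat) : (e = 0 \/ e = 1)%nat ->
  mom (fun t => t ^ (2 * j + e)) (u_res e m n) (u_moment e m n j) /\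
  mom (fun t => t ^ (2 * j + (1 - e))) (u_res e m n) 0.
Proof.
  intros He. induction n as [|n [IH IH']].
  - destruct (mom_ubar e m j He) as [H1 H2]. split; [|exact H2].
    replace (u_moment e m 0 j) with (1 / (j + e + 1 / 2) - 1 / (j + m + 1 + e)); [exact H1|].
    unfold u_moment. simpl. posnat. field. lra.
  - assert (K : mom (fun t => t ^ (2 * j + e)) (psi (2 * n + e)) (psi_moment e n j) /\
      mom (fun t => t ^ (2 * j + (1 - e))) (psi (2 * n + e)) 0).
    { destruct (psi_moments n j) as (K0 & K1 & K2 & K3).
      destruct He as [-> | ->]; simpl (1 - _)%nat; rewrite ?Nat.add_0_r; auto. }
    destruct K as [K0 K1].
    pose proof (mom_u_res_S _ _ _ _ _ _ IH K0) as H.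
    pose proof (mom_u_res_S _ _ _ _ _ _ IH' K1) as H'.
    rewrite Rmult_0_r, Rminus_0_r in H'. split; [|exact H'].
    match type of H with mom _ _ ?v => match goal with |- mom _ _ ?w => replace w with v; [exact H|] end end.
    unfold u_moment, psi_moment. rewrite (zprod_S _ _ (S n)). cbn [u_const]. rewrite !S_INR.
    pose proof (psi_const_pos (2 * n + e)). posnat. field. lra.
Qed.

(** * Identification of the polynomials *)

Lemma poly_S (a : nat -> R) (n : nat) t : poly a (S n) t = poly a n t + a (S n) * t ^ S n.
Proof. unfold poly. rewrite sum_Sn. reflexivity. Qed.

Lemma poly_O (a : nat -> R) t : poly a 0 t = a 0%nat.
Proof. unfold poly. rewrite sum_O. simpl. ring. Qed.

Lemma poly_ext_loc (a b : nat -> R) (n : nat) t :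
  (forall k, (k <= n)%nat -> a k = b k) -> poly a n t = poly b n t.
Proof. intros H. apply sum_n_ext_loc. intros k Hk. now rewrite H. Qed.

Lemma poly_lin (a b : nat -> R) (c d : R) (n : nat) t :
  poly (fun k => c * a k + d * b k) n t = c * poly a n t + d * poly b n t.
Proof.
  induction n as [|n IH]; [rewrite !poly_O; ring|]. rewrite !poly_S, IH. ring.
Qed.

Lemma poly_mult_var (a : nat -> R) (n : nat) t :
  poly (fun k => match k with O => 0 | S k => a k end) (S n) t = t * poly a n t.
Proof.
  induction n as [|n IH]; [rewrite poly_S, !poly_O; ring|].
  rewrite poly_S, IH, poly_S. simpl. ring.
Qed.

(** In [poly a n] the coefficients beyond [n] are arbitrary, so raising the degree bound requires
    cutting them off. *)
Lemma poly_pad (a : nat -> R) (n : nat) t :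
  poly (fun k => if (k <=? n)%nat then a k else 0) (S n) t = poly a n t.
Proof.
  rewrite poly_S. replace (S n <=? n)%nat with false by (symmetry; apply Nat.leb_gt; lia).
  rewrite Rmult_0_l, Rplus_0_r. apply poly_ext_loc. intros k Hk.
  now replace (k <=? n)%nat with true by (symmetry; apply Nat.leb_le; lia).
Qed.

Lemma deg_S (n : nat) f : poly_deg_le n f -> poly_deg_le (S n) f.
Proof.
  intros [a Ha]. eexists. intros t. rewrite Ha. symmetry. apply poly_pad.
Qed.

Lemma deg_le (n m : nat) f : (n <= m)%nat -> poly_deg_le n f -> poly_deg_le m f.
Proof. induction 1; [trivial|]. intros H1. apply deg_S. auto. Qed.

Lemma deg_lin (n : nat) (f g : R -> R) (c d : R) :
  poly_deg_le n f -> poly_deg_le n g -> poly_deg_le n (fun t => c * f t + d * g t).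
Proof.
  intros [a Ha] [b Hb]. eexists. intros t. rewrite Ha, Hb. symmetry. apply poly_lin.
Qed.

Lemma deg_mult_var (n : nat) f : poly_deg_le n f -> poly_deg_le (S n) (fun t => t * f t).
Proof. intros [a Ha]. eexists. intros t. rewrite Ha. symmetry. apply poly_mult_var. Qed.

Lemma deg_ext (n : nat) (f g : R -> R) : (forall t, f t = g t) -> poly_deg_le n f -> poly_deg_le n g.
Proof. intros E [a Ha]. exists a. intros t. now rewrite <- E. Qed.

Lemma monic_deg (n : nat) f : poly_monic n f -> poly_deg_le n f.
Proof. intros [a [_ Ha]]. now exists a. Qed.

Lemma continuous_poly (a : nat -> R) (n : nat) t : continuous (poly a n) t.
Proof.
  induction n as [|n IH].
  - apply continuous_ext with (fun _ => a 0%nat); [intros; now rewrite poly_O|]. apply continuous_const.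
  - apply continuous_ext with (fun t => plus (poly a n t) (a (S n) * t ^ S n)).
    { intros; now rewrite poly_S. }
    apply (continuous_plus (poly a n) (fun t => a (S n) * t ^ S n)); [exact IH|].
    apply (ex_derive_continuous (fun t => a (S n) * t ^ S n)). auto_derive; trivial.
Qed.

Lemma continuous_deg (n : nat) f t : poly_deg_le n f -> continuous f t.
Proof.
  intros [a Ha]. apply continuous_ext with (poly a n); [intros; now rewrite Ha|].
  apply continuous_poly.
Qed.

Lemma monic_gegen (n : nat) : poly_monic n (gegen n).
Proof.
  induction n as [n IH] using (well_founded_induction Wf_nat.lt_wf).
  destruct n as [|[|n]].
  - exists (fun _ => 1). split; [reflexivity|]. intros t. now rewrite poly_O.
  - exists (fun k => match k with O => 0 | _ => 1 end). split; [reflexivity|].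
    intros t. rewrite poly_S, poly_O. simpl. ring.
  - destruct (IH (S n) ltac:(lia)) as (a & Ha & Ea). destruct (IH n ltac:(lia)) as (b & Hb & Eb).
    set (c := (n + 1) * (n + 5) / ((2 * n + 7) * (2 * n + 5))).
    (* Two paddings lift the polynomial of degree [n] to the formal degree [n + 2] without touching
       the leading coefficient. *)
    set (b1 := fun k => if (k <=? n)%nat then b k else 0).
    set (b2 := fun k => if (k <=? S n)%nat then b1 k else 0).
    exists (fun k => 1 * match k with O => 0 | S k => a k end + - c * b2 k). split.
    + unfold b2. replace (S (S n) <=? S n)%nat with false by (symmetry; apply Nat.leb_gt; lia).
      rewrite Ha. ring.
    + intros t. rewrite gegen_SS, poly_lin, poly_mult_var. fold c. unfold b2, b1.
      rewrite !poly_pad, <- Ea, <- Eb. ring.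
Qed.

Lemma mom_poly (f : R -> R) (b mu : nat -> R) (n : nat) :
  (forall k, (k <= n)%nat -> mom (fun t => t ^ k) f (mu k)) ->
  mom (poly b n) f (sum_n (fun k => b k * mu k) n).
Proof.
  induction n as [|n IH]; intros H.
  - rewrite sum_O. pose proof (mom_lin _ _ _ _ _ (b 0%nat) 0 (H 0%nat (le_n _)) (H 0%nat (le_n _))) as K.
    rewrite Rmult_0_l, Rplus_0_r in K. refine (mom_conv _ _ _ _ _ _ K).
    intros t. rewrite poly_O. simpl. ring.
  - rewrite sum_Sn.
    pose proof (IH (fun k Hk => H k (Nat.le_trans _ _ _ Hk (Nat.le_succ_diag_r n)))) as K1.
    pose proof (mom_lin _ _ _ _ _ (b (S n)) 0 (H _ (le_n _)) (H _ (le_n _))) as K2.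
    rewrite Rmult_0_l, Rplus_0_r in K2.
    refine (is_RInt_ext _ _ _ _ _ _ (is_RInt_plus (V := R_NormedModule) _ _ _ _ _ _ K1 K2)).
    intros t _. rewrite poly_S. unfold plus; simpl. ring.
Qed.

(** * Uniqueness of the orthogonal polynomial and of the projection *)

(** The primitive of the square is monotone with equal values at both ends, hence constant on the
    interval, and its derivative there is the square itself. *)
Lemma is_RInt_sqr_0 (d : R -> R) : (forall t, continuous d t) ->
  is_RInt (fun t => d t * d t) (-1) 1 0 -> forall t, -1 < t < 1 -> d t = 0.
Proof.
  intros Cd H0 t Ht.
  set (f := fun t => d t * d t).
  assert (Cf : forall t, continuous f t) by (intros x; apply (continuous_mult d d); apply Cd).
  assert (Ex : forall a b, ex_RInt f a b)
    by (intros a b; apply (ex_RInt_continuous (V := R_CompleteNormedModule)); intros; apply Cf).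
  assert (Pos : forall a b, a <= b -> 0 <= RInt f a b).
  { intros a b Hab. apply RInt_ge_0; [exact Hab | apply Ex |]. intros x _. unfold f. nra. }
  assert (G : forall x, -1 < x < 1 -> RInt f (-1) x = 0).
  { intros x Hx. pose proof (RInt_Chasles f (-1) x 1 (Ex _ _) (Ex _ _)) as Hc.
    rewrite (is_RInt_unique f (-1) 1 0 H0) in Hc. unfold plus in Hc; simpl in Hc.
    pose proof (Pos (-1) x ltac:(lra)). pose proof (Pos x 1 ltac:(lra)). lra. }
  assert (D1 : is_derive (RInt f (-1)) t (f t)).
  { apply (is_derive_RInt f _ (-1)); [|apply Cf]. apply filter_forall. intros x.
    apply (RInt_correct f), Ex. }
  assert (D2 : is_derive (RInt f (-1)) t 0).
  { apply is_derive_ext_loc with (fun _ => 0); [|apply (is_derive_const (0 : R_NormedModule))].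
    assert (P : 0 < Rmin (t - -1) (1 - t)) by (apply Rmin_pos; lra).
    exists (mkposreal _ P). intros y Hy. symmetry. apply G.
    unfold ball in Hy; simpl in Hy; unfold AbsRing_ball in Hy; simpl in Hy.
    unfold abs, minus, plus, opp in Hy; simpl in Hy.
    pose proof (Rmin_l (t - -1) (1 - t)). pose proof (Rmin_r (t - -1) (1 - t)).
    apply Rabs_def2 in Hy. lra. }
  apply is_derive_unique in D1. apply is_derive_unique in D2.
  rewrite D1 in D2. unfold f in D2. nra.
Qed.

(** For [lam = 5 / 2] the weight agrees on the open interval with a polynomial, so the improper
    integral becomes an ordinary one: the integral of a continuous function is continuous in both
    bounds jointly. *)
Lemma is_RInt_gen_closed (f g : R -> R) v : (forall t, continuous g t) ->
  (forall t, -1 < t < 1 -> f t = g t) -> is_RInt g (-1) 1 v ->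
  is_RInt_gen f (at_right (-1)) (at_left 1) v.
Proof.
  intros Cg E H.
  assert (Ex : forall a b, ex_RInt g a b)
    by (intros a b; apply (ex_RInt_continuous (V := R_CompleteNormedModule)); intros; apply Cg).
  apply (is_RInt_gen_ext g f).
  (* Separating the two bounds by 0 keeps them in order and inside the open interval, where [f] and
     [g] agree. *)
  { apply (Filter_prod _ _ _ (fun a => -1 < a < 0) (fun b => 0 < b < 1)).
    - exists (mkposreal 1 Rlt_0_1). intros a Ha Ha'.
      unfold ball in Ha; simpl in Ha; unfold AbsRing_ball in Ha; simpl in Ha.
      unfold abs, minus, plus, opp in Ha; simpl in Ha. apply Rabs_def2 in Ha. lra.
    - exists (mkposreal 1 Rlt_0_1). intros a Ha Ha'.
      unfold ball in Ha; simpl in Ha; unfold AbsRing_ball in Ha; simpl in Ha.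
      unfold abs, minus, plus, opp in Ha; simpl in Ha. apply Rabs_def2 in Ha. lra.
    - intros a b Ha Hb x. simpl. rewrite Rmin_left, Rmax_right by lra. intros Hx.
      symmetry. apply E. lra. }
  pose proof (continuous_RInt (V := R_NormedModule) g (-1) 1 (RInt g)) as C.
  assert (C' : continuous (fun z : R * R => RInt g (fst z) (snd z)) (-1, 1)).
  { apply C. apply filter_forall. intros z. apply (RInt_correct g), Ex. }
  intros P HP. unfold filtermapi.
  simpl in C'. specialize (C' P). unfold filtermap in C'. simpl in C'.
  rewrite (is_RInt_unique g (-1) 1 v H) in C'. specialize (C' HP).
  destruct C' as [eps He].
  apply (Filter_prod _ _ _ (fun a => ball (-1) eps a) (fun b => ball 1 eps b)).
  - exists eps. intros a Ha _. exact Ha.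
  - exists eps. intros a Ha _. exact Ha.
  - intros a b Ha Hb. exists (RInt g a b). split; [apply (RInt_correct g), Ex|].
    apply (He (a, b)). split; assumption.
Qed.

Lemma is_RInt_gen_closed_inv (f g : R -> R) v : (forall t, continuous g t) ->
  (forall t, -1 < t < 1 -> f t = g t) -> is_RInt_gen f (at_right (-1)) (at_left 1) v ->
  is_RInt g (-1) 1 v.
Proof.
  intros Cg E H.
  assert (Ex : ex_RInt g (-1) 1)
    by (apply (ex_RInt_continuous (V := R_CompleteNormedModule)); intros; apply Cg).
  destruct Ex as [w Hw].
  pose proof (is_RInt_gen_closed f g w Cg E Hw) as H1.
  rewrite <- (is_RInt_gen_unique (V := R_CompleteNormedModule) f v H).
  rewrite (is_RInt_gen_unique (V := R_CompleteNormedModule) f w H1). exact Hw.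
Qed.

Lemma zprod_nat_0 (e : R) (j n : nat) : (j < n)%nat -> zprod e j n = 0.
Proof.
  induction n as [|n IH]; [lia|]. intros H. rewrite zprod_S.
  destruct (Nat.eq_dec j n) as [->|Hn].
  - unfold Rdiv. ring.
  - rewrite IH by lia. ring.
Qed.

Lemma nat_parity (k : nat) : exists j, k = (2 * j)%nat \/ k = (2 * j + 1)%nat.
Proof. destruct (Nat.Even_or_Odd k) as [[j H]|[j H]]; exists j; auto. Qed.

(** The factor [(1 + (-1) ^ (n + k)) / 2] selects the orders of the parity of [n]. The bound on [k]
    is exactly what makes the product in [psi_moment] vanish. *)
Lemma mom_psi_low (n k : nat) : (k <= n + 1)%nat ->
  mom (fun t => t ^ k) (psi n) (psi_const n * (1 + (-1) ^ (n + k)) / 2).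
Proof.
  intros Hk.
  assert (P : forall e i j : nat, (j <= i)%nat -> psi_moment e i j = psi_const (2 * i + e)).
  { intros e i j Hj. unfold psi_moment. rewrite zprod_nat_0 by lia. ring. }
  destruct (nat_parity n) as [i Hi]. destruct (nat_parity k) as [j Hj].
  destruct (psi_moments i j) as (H0 & H1 & H2 & H3).
  destruct Hi as [-> | ->], Hj as [-> | ->]; rewrite ?P in * by lia; rewrite ?Nat.add_0_r in *.
  - replace (_ / 2) with (psi_const (2 * i)); [exact H0|].
    rewrite pow_add, !pow_m1_even. field.
  - replace (_ / 2) with 0; [exact H1|].
    rewrite !pow_add, !pow_m1_even. field.
  - replace (_ / 2) with 0; [exact H3|].
    rewrite !pow_add, !pow_m1_even. field.
  - replace (_ / 2) with (psi_const (2 * i + 1)); [exact H2|].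
    rewrite !pow_add, !pow_m1_even. field.
Qed.

Lemma ultraspherical_weight (lam x : R) : lam = 5 / 2 -> -1 < x < 1 ->
  Rpower (1 - x ^ 2) (lam - 1 / 2) = (1 - x ^ 2) ^ 2.
Proof.
  intros -> Hx. replace (5 / 2 - 1 / 2) with (INR 2) by (simpl; field).
  apply Rpower_pow. nra.
Qed.

Lemma continuous_weighted (m n : nat) f g t : poly_deg_le m f -> poly_deg_le n g ->
  continuous (fun x => f x * g x * (1 - x ^ 2) ^ 2) t.
Proof.
  intros Hf Hg. apply (continuous_mult (fun x => f x * g x) (fun x => (1 - x ^ 2) ^ 2)).
  - apply (continuous_mult f g); eapply continuous_deg; eassumption.
  - apply (ex_derive_continuous (fun x => (1 - x ^ 2) ^ 2)). auto_derive; trivial.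
Qed.

(** The weight is [(1 - t ^ 2) ^ 2]; one factor is contained in [psi n], the other gives the
    difference of the moments of orders [k] and [k + 2]. For [k < n] both are low and have the same
    parity, so they cancel. *)
Lemma gegen_ultraspherical (n : nat) : is_ultraspherical (5 / 2) n (gegen n).
Proof.
  split; [apply monic_gegen|]. intros m q Hm Hq.
  apply is_RInt_gen_closed with (fun x => gegen n x * q x * (1 - x ^ 2) ^ 2).
  - intros t. eapply continuous_weighted; [apply monic_deg, monic_gegen | exact Hq].
  - intros t Ht. now rewrite ultraspherical_weight.
  - destruct Hq as [b Hb].
    assert (H : mom (poly b m) (fun t => (1 - t ^ 2) * psi n t) (sum_n (fun k => b k * 0) m)).
    { apply mom_poly. intros k Hk.
      pose proof (mom_psi_low n k ltac:(lia)) as H0.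
      pose proof (mom_shift k 2 _ _ (mom_psi_low n (k + 2) ltac:(lia))) as H2.
      pose proof (mom_lin _ _ _ _ _ 1 (-1) H0 H2) as H.
      match type of H with mom _ _ ?v => replace 0 with v end.
      - refine (mom_conv _ _ _ _ _ _ H). intros t. ring.
      - replace (n + (k + 2))%nat with (n + k + 2 * 1)%nat by lia.
        rewrite (pow_add _ _ (2 * 1)), pow_m1_even. field. }
    replace (sum_n _ m) with 0 in H.
    + refine (is_RInt_ext _ _ _ _ _ _ H). intros t _. rewrite Hb. unfold psi.
      simpl. ring.
    + symmetry. clear. induction m as [|m IH]; [rewrite sum_O; ring|].
      rewrite sum_Sn, IH. unfold plus; simpl. ring.
Qed.

(** Two monic solutions differ by a polynomial of lower degree, which is orthogonal to both of them
    and therefore to itself. *)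
Lemma ultraspherical_gegen (n : nat) t : -1 < t < 1 -> ultraspherical (5 / 2) n t = gegen n t.
Proof.
  intros Ht. unfold ultraspherical.
  pose proof (epsilon_spec (inhabits (fun _ : R => 0)) (is_ultraspherical (5 / 2) n)
    (ex_intro _ _ (gegen_ultraspherical n))) as Hp.
  set (p := epsilon _ _) in *. clearbody p.
  pose proof (gegen_ultraspherical n) as Hg. revert Hp Hg. set (g := gegen n). clearbody g.
  intros [Mp Op] [Mg Og].
  destruct n as [|n].
  - destruct Mp as (a & Ha & Ea), Mg as (b & Hb & Eb). rewrite Ea, Eb, !poly_O. congruence.
  - set (d := fun t => 1 * p t + -1 * g t).
    assert (Dd : poly_deg_le n d).
    { destruct Mp as (a & Ha & Ea), Mg as (b & Hb & Eb).
      exists (fun k => 1 * a k + -1 * b k). intros x. unfold d. rewrite Ea, Eb, !poly_S, poly_lin, Ha, Hb. ring. }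
    assert (O : forall f, poly_monic (S n) f ->
      (forall (m : nat) (q : R -> R), (m < S n)%nat -> poly_deg_le m q ->
        is_RInt_gen (fun x => f x * q x * Rpower (1 - x ^ 2) (5 / 2 - 1 / 2))
        (at_right (-1)) (at_left 1) 0) -> mom (fun t => d t * (1 - t ^ 2) ^ 2) f 0).
    { intros f Mf Of. specialize (Of n d (le_n _) Dd).
      apply is_RInt_gen_closed_inv with (g := fun x => f x * d x * (1 - x ^ 2) ^ 2) in Of.
      - refine (is_RInt_ext _ _ _ _ _ _ Of). intros x _. simpl. ring.
      - intros x. eapply continuous_weighted; [apply monic_deg; exact Mf | exact Dd].
      - intros x Hx. now rewrite ultraspherical_weight. }
    pose proof (mom_lin _ _ _ _ _ 1 (-1) (O _ Mp Op) (O _ Mg Og)) as H.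
    replace (1 * 0 + -1 * 0) with 0 in H by ring.
    (* The weight is a perfect square, so it is absorbed into the function whose square is
       integrated. *)
    assert (H' : is_RInt (fun t => (d t * (1 - t ^ 2)) * (d t * (1 - t ^ 2))) (-1) 1 0).
    { refine (is_RInt_ext _ _ _ _ _ _ H). intros x _. fold (d x). simpl. ring. }
    pose proof (is_RInt_sqr_0 (fun t => d t * (1 - t ^ 2))) as K.
    assert (E0 : d t * (1 - t ^ 2) = 0).
    { apply K; [|exact H'|exact Ht]. intros x.
      apply (continuous_mult d (fun t => 1 - t ^ 2)); [eapply continuous_deg; exact Dd|].
      apply (ex_derive_continuous (fun x => 1 - x ^ 2)). auto_derive; trivial. }
    apply Rmult_integral in E0. destruct E0 as [E0|E0]; [unfold d in E0; lra | nra].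
Qed.

Lemma phi_psi (n : nat) t : -1 < t < 1 -> phi (n + 2) t = psi n t.
Proof.
  intros Ht. unfold phi, psi. replace (n + 2 - 2)%nat with n by lia.
  now rewrite ultraspherical_gegen.
Qed.

(** The difference of two projections lies in the range and is orthogonal to the range, hence to
    itself. *)
Lemma proj_eq (N : nat) (f p : R -> R) t : is_proj N f p -> -1 < t < 1 -> proj N f t = p t.
Proof.
  intros Hp Ht. unfold proj.
  pose proof (epsilon_spec (inhabits (fun _ : R => 0)) (is_proj N f) (ex_intro _ _ Hp)) as Hq.
  set (q := epsilon _ _) in *. clearbody q.
  destruct Hp as [[Dp [Lp Rp]] Op], Hq as [[Dq [Lq Rq]] Oq].
  set (d := fun t => 1 * q t + -1 * p t).
  assert (Dd : poly_deg_le N d) by (apply deg_lin; assumption).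
  assert (Vd : poly_vanishing N d) by (repeat split; [exact Dd | unfold d; lra | unfold d; lra]).
  assert (H : is_RInt (fun t => d t * d t) (-1) 1 0).
  { pose proof (is_RInt_minus (V := R_NormedModule) _ _ _ _ _ _ (Op d Vd) (Oq d Vd)) as H.
    match type of H with is_RInt _ _ _ ?v => replace v with 0 in H by (unfold minus, plus, opp; simpl; ring) end.
    refine (is_RInt_ext _ _ _ _ _ _ H). intros x _. unfold minus, plus, opp, d; simpl. ring. }
  pose proof (is_RInt_sqr_0 d (fun x => continuous_deg _ _ x Dd) H t Ht) as E.
  unfold d in E. lra.
Qed.

(* The moment of [g] against [q] is a combination of [q 1] and [q (-1)]. *)
Lemma residual_orthogonal (N : nat) (g q : R -> R) (a b : R) :
  (forall k, (k <= N)%nat -> mom (fun t => t ^ k) g (a + b * (-1) ^ k)) ->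
  poly_vanishing N q -> is_RInt (fun t => g t * q t) (-1) 1 0.
Proof.
  intros H [[c Hc] [L R]].
  pose proof (mom_poly g c _ N H) as K.
  replace (sum_n _ N) with (a * poly c N 1 + b * poly c N (-1)) in K.
  - rewrite <- !Hc, L, R in K. replace (a * 0 + b * 0) with 0 in K by ring.
    refine (is_RInt_ext _ _ _ _ _ _ K). intros t _. rewrite Hc. apply Rmult_comm.
  - clear. induction N as [|N IH].
    + rewrite !poly_O, sum_O. simpl. ring.
    + rewrite !poly_S, sum_Sn, <- IH, pow1. unfold plus; simpl. ring.
Qed.

Lemma is_proj_residual (N : nat) (f g : R -> R) (a b : R) :
  poly_vanishing N (fun t => f t - g t) ->
  (forall k, (k <= N)%nat -> mom (fun t => t ^ k) g (a + b * (-1) ^ k)) ->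
  is_proj N f (fun t => f t - g t).
Proof.
  intros V H. split; [exact V|]. intros q Hq.
  refine (is_RInt_ext _ _ _ _ _ _ (residual_orthogonal N g q a b H Hq)).
  intros t _. simpl. ring.
Qed.

Lemma vanishing_psi (n : nat) : poly_vanishing (n + 2) (psi n).
Proof.
  repeat split; [|unfold psi; simpl; ring|unfold psi; simpl; ring].
  pose proof (monic_deg _ _ (monic_gegen n)) as H.
  pose proof (deg_mult_var _ _ (deg_mult_var _ _ H)) as H2.
  replace (n + 2)%nat with (S (S n)) by lia.
  apply deg_ext with (2 := deg_lin _ _ _ 1 (-1) (deg_S _ _ (deg_S _ _ H)) H2).
  intros t. unfold psi. ring.
Qed.

Lemma vanishing_le (n m : nat) f : (n <= m)%nat -> poly_vanishing n f -> poly_vanishing m f.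
Proof. intros H [D V]. split; [eapply deg_le; eassumption | exact V]. Qed.

Lemma vanishing_lin (n : nat) (f g : R -> R) (c d : R) :
  poly_vanishing n f -> poly_vanishing n g -> poly_vanishing n (fun t => c * f t + d * g t).
Proof.
  intros [D [L R]] [D' [L' R']]. split; [now apply deg_lin|]. rewrite L, R, L', R'. lra.
Qed.

Lemma vanishing_ext (n : nat) (f g : R -> R) : (forall t, f t = g t) -> poly_vanishing n f -> poly_vanishing n g.
Proof. intros E [D V]. split; [now apply deg_ext with f|]. now rewrite <- !E. Qed.

Lemma vanishing_0 (n : nat) (f : R -> R) : (forall t, f t = 0) -> poly_vanishing n f.
Proof.
  intros H. split; [|split; apply H]. exists (fun _ => 0). intros t. rewrite H.
  induction n as [|n IH]; [now rewrite poly_O|]. rewrite poly_S, <- IH. ring.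
Qed.

Lemma r0_moment_low (e : R) (n j : nat) : (j <= n)%nat -> r0_moment e n j = / ((n + 1) * (n + 1 / 2 + e)).
Proof. intros H. unfold r0_moment. rewrite zprod_nat_0 by lia. ring. Qed.

Lemma r0_eq_res (n : nat) t : -1 < t < 1 -> r0 (n + 1) t = r0_res n t.
Proof.
  intros Ht. unfold r0.
  assert (V : poly_vanishing (n + 1) (fun t => 1 + t - r0_res n t)).
  { induction n as [|n IH].
    - apply vanishing_0. intros x. simpl. ring.
    - apply (vanishing_le _ (S n + 1)) in IH; [|lia].
      pose proof (vanishing_psi n) as K. apply (vanishing_le _ (S n + 1)) in K; [|lia].
      refine (vanishing_ext _ _ _ _ (vanishing_lin _ _ _ 1
        (8 / psi_const n * (1 / ((n + 1) * (n + 3)) - 1 / ((n + 2) * (n + 4)))) IH K)).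
      intros x. cbn [r0_res]. ring. }
  assert (H : exists a b, forall k, (k <= n + 1)%nat -> mom (fun t => t ^ k) (r0_res n) (a + b * (-1) ^ k)).
  { destruct (nat_parity n) as [i [-> | ->]].
    (* [x] and [y] are the common values of the even and of the odd low moments; the witnesses solve
       [a + b = x] and [a - b = y]. *)
    - set (x := / ((i + 1) * (i + 1 / 2 + 0))). set (y := / ((i + 1) * (i + 1 / 2 + 1))).
      exists ((x + y) / 2), ((x - y) / 2). intros k Hk.
      destruct (nat_parity k) as [j [-> | ->]];
        destruct (r0_res_moments i j) as [[H0 H1] _].
      + rewrite r0_moment_low in H0 by lia. rewrite pow_m1_even. replace (_ + _) with x by field. exact H0.
      + rewrite r0_moment_low in H1 by lia. rewrite pow_add, pow_m1_even. replace (_ + _) with y by field. exact H1.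
    - set (x := / ((S i + 1) * (S i + 1 / 2 + 0))). set (y := / ((i + 1) * (i + 1 / 2 + 1))).
      exists ((x + y) / 2), ((x - y) / 2). intros k Hk.
      destruct (nat_parity k) as [j [-> | ->]];
        destruct (r0_res_moments i j) as [_ [H0 H1]].
      + rewrite r0_moment_low in H0 by lia. rewrite pow_m1_even. replace (_ + _) with x by field. exact H0.
      + rewrite r0_moment_low in H1 by lia. rewrite pow_add, pow_m1_even. replace (_ + _) with y by field. exact H1. }
  destruct H as (a & b & H).
  assert (P : proj (n + 1) (fun s => 1 + s) t = 1 + t - r0_res n t).
  { apply (proj_eq _ _ (fun t => 1 + t - r0_res n t)); [|exact Ht].
    exact (is_proj_residual _ (fun s => 1 + s) _ a b V H). }
  rewrite P. ring.
Qed.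

Lemma u_eq_res (n m e : nat) t : (e = 0 \/ e = 1)%nat -> -1 < t < 1 ->
  u (2 * n + 1 + e) (2 * Z.of_nat n - 2 * Z.of_nat m) t = u_res e m n t.
Proof.
  intros He Ht. unfold u.
  (* The index [M = N - k] does not depend on [n]: the projected function stays fixed while the
     degree grows. *)
  replace (Z.to_nat _) with (2 * m + 1 + e)%nat by lia.
  assert (V : poly_vanishing (2 * n + 1 + e) (fun t => ubar (2 * m + 1 + e) t - u_res e m n t)).
  { induction n as [|n IH].
    - apply vanishing_0. intros x. cbn [u_res]. ring.
    - apply (vanishing_le _ (2 * S n + 1 + e)) in IH; [|lia].
      pose proof (vanishing_psi (2 * n + e)) as K. apply (vanishing_le _ (2 * S n + 1 + e)) in K; [|lia].
      refine (vanishing_ext _ _ _ _ (vanishing_lin _ _ _ 1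
        ((u_const e m n - u_const e m (S n)) / psi_const (2 * n + e)) IH K)).
      intros x. change (u_res e m (S n) x) with (u_res e m n x - (u_const e m n - u_const e m (S n)) / psi_const (2 * n + e) * psi (2 * n + e) x). ring. }
  (* The moments of the parity opposite to [e] vanish, so the constant is split evenly between the
     two endpoints, with the sign [(-1) ^ e] at -1. *)
  assert (H : forall k, (k <= 2 * n + 1 + e)%nat ->
    mom (fun t => t ^ k) (u_res e m n) (u_const e m n / 2 + u_const e m n / 2 * (-1) ^ e * (-1) ^ k)).
  { intros k Hk.
    assert (Hj : exists j, k = (2 * j + e)%nat \/ k = (2 * j + (1 - e))%nat).
    { destruct (nat_parity k) as [j Hj]. exists j. lia. }
    destruct Hj as [j [-> | ->]]; destruct (u_res_moments e m n j He) as [H0 H1].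
    - match goal with |- mom _ _ ?v => replace v with (u_moment e m n j) end; [exact H0|].
      unfold u_moment. rewrite zprod_nat_0 by lia. rewrite pow_add, pow_m1_even.
      transitivity (u_const e m n / 2 + u_const e m n / 2 * ((-1) ^ e * (-1) ^ e)); [rewrite pow_m1_e2; field; posnat; lra | ring].
    - match goal with |- mom _ _ ?v => replace v with 0 end; [exact H1|]. rewrite pow_add, pow_m1_even.
      destruct He as [-> | ->]; simpl; field. }
  rewrite (proj_eq _ _ _ _ (is_proj_residual _ _ _ _ _ V H) Ht). ring.
Qed.

(** * Series *)

Lemma is_series_lin (a b : nat -> R) (c d la lb : R) :
  is_series a la -> is_series b lb -> is_series (fun k => c * a k + d * b k) (c * la + d * lb).
Proof.
  intros Ha Hb.
  exact (is_series_plus (V := R_NormedModule) _ _ _ _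
    (is_series_scal (V := R_NormedModule) c a la Ha) (is_series_scal (V := R_NormedModule) d b lb Hb)).
Qed.

Lemma is_series_Rmult (a : nat -> R) (c l : R) : is_series a l -> is_series (fun k => c * a k) (c * l).
Proof. exact (is_series_scal (V := R_NormedModule) c a l). Qed.

Lemma is_series_eq (a b : nat -> R) (l l' : R) :
  (forall k, a k = b k) -> l = l' -> is_series a l -> is_series b l'.
Proof. intros E <-. now apply is_series_ext. Qed.

Lemma is_series_uniq (a : nat -> R) (l l' : R) : is_series a l -> is_series a l' -> l = l'.
Proof. intros H H'. now rewrite <- (is_series_unique _ _ H), <- (is_series_unique _ _ H'). Qed.

Lemma sum_n_le_series (a : nat -> R) (l : R) (n : nat) :
  (forall k, 0 <= a k) -> is_series a l -> sum_n a n <= l.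
Proof.
  intros Ha H. apply (is_lim_seq_incr_compare (sum_n a) l); [exact H|].
  intros k. rewrite sum_Sn. unfold plus; simpl. specialize (Ha (S k)). lra.
Qed.

Lemma sum_n_lin (a b : nat -> R) (c d : R) (n : nat) :
  sum_n (fun k => c * a k + d * b k) n = c * sum_n a n + d * sum_n b n.
Proof.
  induction n as [|n IH]; [now rewrite !sum_O|]. rewrite !sum_Sn, IH. unfold plus; simpl. ring.
Qed.

Lemma series_remainder (a c : nat -> R) (s l : R) (n : nat) :
  (forall k, Rabs (a k) <= c k) -> is_series a s -> is_series c l ->
  Rabs (s - sum_n a n) <= l - sum_n c n.
Proof.
  intros H Ha Hc.
  (* For either sign [d], the series of [c k - d * a k] has nonnegative terms, so its partial sums
     stay below its sum. *)
  assert (P : forall d, d = 1 \/ d = -1 -> d * (s - sum_n a n) <= l - sum_n c n).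
  { intros d Hd.
    pose proof (sum_n_le_series _ _ n (fun k => ltac:(idtac; specialize (H k);
      destruct (Rabs_le_between (a k) (c k)) as [H' _]; specialize (H' H);
      destruct Hd; subst d; lra) : 0 <= 1 * c k + - d * a k) (is_series_lin _ _ 1 (- d) _ _ Hc Ha)) as K.
    rewrite sum_n_lin in K. lra. }
  apply Rabs_le. pose proof (P 1 (or_introl eq_refl)). pose proof (P (-1) (or_intror eq_refl)). lra.
Qed.

(* The dominated series converges uniformly on the interval, so it can be integrated
   term by term. *)
Lemma is_series_mom (h : nat -> R -> R) (f g : R -> R) (b v : nat -> R) (I : R) :
  (forall k t, -1 <= t <= 1 -> Rabs (h k t) <= 1) ->
  ex_series (fun k => Rabs (b k)) ->
  (forall t, -1 <= t <= 1 -> is_series (fun k => b k * h k t) (f t)) ->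
  (forall t, continuous g t) ->
  (forall k, mom (h k) g (v k)) -> mom f g I ->
  is_series (fun k => b k * v k) I.
Proof.
  intros Hh [l Hl] Hf Cg Hv HI.
  assert (Ex : ex_RInt (fun t => Rabs (g t)) (-1) 1).
  { apply (ex_RInt_continuous (V := R_CompleteNormedModule)). intros t _.
    apply (continuous_comp g Rabs); [apply Cg | apply continuous_Rabs]. }
  destruct Ex as [L HL].
  assert (Hn : forall n, mom (fun t => sum_n (fun k => b k * h k t) n) g (sum_n (fun k => b k * v k) n)).
  { induction n as [|n IH].
    - rewrite sum_O. refine (is_RInt_ext _ _ _ _ _ _ (is_RInt_scal (V := R_NormedModule) _ _ _ (b 0%nat) _ (Hv 0%nat))).
      intros t _. rewrite sum_O. unfold scal; simpl; unfold mult; simpl. ring.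
    - rewrite sum_Sn.
      refine (is_RInt_ext _ _ _ _ _ _ (is_RInt_plus (V := R_NormedModule) _ _ _ _ _ _ IH
        (is_RInt_scal (V := R_NormedModule) _ _ _ (b (S n)) _ (Hv (S n))))).
      intros t _. rewrite sum_Sn. unfold plus, scal; simpl; unfold mult; simpl. ring. }
  (* The error is at most the tail of the dominating series times [L], the integral of the absolute
     value of [g]. *)
  assert (Bd : forall n, Rabs (I - sum_n (fun k => b k * v k) n) <= (l - sum_n (fun k => Rabs (b k)) n) * L).
  { intros n.
    apply (norm_RInt_le (V := R_NormedModule)
      (fun t => (f t - sum_n (fun k => b k * h k t) n) * g t)
      (fun t => (l - sum_n (fun k => Rabs (b k)) n) * Rabs (g t)) (-1) 1); [lra| | |].
    - intros t Ht. unfold norm; simpl; unfold abs; simpl. rewrite Rabs_mult.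
      apply Rmult_le_compat_r; [apply Rabs_pos|].
      apply series_remainder; [|now apply Hf|exact Hl].
      intros k. rewrite Rabs_mult. rewrite <- (Rmult_1_r (Rabs (b k))) at 2.
      apply Rmult_le_compat_l; [apply Rabs_pos | now apply Hh].
    - refine (is_RInt_ext _ _ _ _ _ _ (is_RInt_minus (V := R_NormedModule) _ _ _ _ _ _ HI (Hn n))).
      intros t _. unfold minus, plus, opp; simpl. ring.
    - exact (is_RInt_scal (V := R_NormedModule) _ _ _ _ _ HL). }
  assert (Lim : is_lim_seq (fun n => (l - sum_n (fun k => Rabs (b k)) n) * L) 0).
  { replace 0 with ((l - l) * L) by ring.
    apply (is_lim_seq_mult' _ (fun _ => L)); [|apply is_lim_seq_const].
    apply is_lim_seq_minus'; [apply is_lim_seq_const | exact Hl]. }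
  assert (between : forall p q z : R, Rabs (p - z) <= q -> p - q <= z <= p + q).
  { intros p q z H. apply Rabs_le_between in H. lra. }
  apply (is_lim_seq_le_le (fun n => I - (l - sum_n (fun k => Rabs (b k)) n) * L) _
    (fun n => I + (l - sum_n (fun k => Rabs (b k)) n) * L) I).
  - intros n. apply between. exact (Bd n).
  - replace (Finite I) with (Finite (I - 0)) by (f_equal; ring).
    apply is_lim_seq_minus'; [apply is_lim_seq_const | exact Lim].
  - replace (Finite I) with (Finite (I + 0)) by (f_equal; ring).
    apply is_lim_seq_plus'; [apply is_lim_seq_const | exact Lim].
Qed.

Lemma is_series_cos (x : R) : is_series (fun k => (-1) ^ k / fact (2 * k) * x ^ (2 * k)) (cos x).
Proof.
  apply is_series_Reals. unfold cos. destruct (exist_cos (Rsqr x)) as [l Hl].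
  unfold cos_in in Hl. apply is_series_Reals. apply is_series_Reals in Hl.
  refine (is_series_eq _ _ _ _ _ eq_refl Hl). intros k. unfold cos_n.
  rewrite pow_mult. unfold Rsqr. simpl (x ^ 2). now rewrite Rmult_1_r.
Qed.

Lemma is_series_sin (x : R) : is_series (fun k => (-1) ^ k / fact (2 * k + 1) * x ^ (2 * k + 1)) (sin x).
Proof.
  unfold sin. destruct (exist_sin (Rsqr x)) as [l Hl].
  unfold sin_in in Hl. apply is_series_Reals in Hl.
  apply (is_series_scal (V := R_NormedModule) x) in Hl.
  refine (is_series_eq _ _ _ _ _ eq_refl Hl). intros k. unfold sin_n, scal; simpl; unfold mult; simpl.
  replace (k + (k + 0))%nat with (2 * k)%nat by lia.
  rewrite pow_add, pow_mult. unfold Rsqr. replace (x ^ 2) with (x * x) by ring. ring.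
Qed.

Lemma is_series_exp (x : R) : is_series (fun k => x ^ k / fact k) (exp x).
Proof.
  refine (is_series_eq _ _ _ _ _ eq_refl (is_exp_Reals x)). intros k.
  rewrite pow_n_pow. unfold scal; simpl; unfold mult; simpl. reflexivity.
Qed.

(** * Real Pochhammer symbols and hypergeometric series *)

Fixpoint rpoch (a : R) (n : nat) : R := match n with O => 1 | S n => rpoch a n * (a + n) end.

Lemma rpoch_S a (n : nat) : rpoch a (S n) = rpoch a n * (a + n).
Proof. reflexivity. Qed.

Lemma rpoch_pos a (n : nat) : 0 < a -> 0 < rpoch a n.
Proof.
  intros Ha; induction n as [|n IH]; [simpl; lra|]. rewrite rpoch_S. posnat.
  apply Rmult_lt_0_compat; lra.
Qed.

Lemma rpoch_add a (n k : nat) : rpoch a (n + k) = rpoch a n * rpoch (a + n) k.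
Proof.
  induction k as [|k IH]; [rewrite Nat.add_0_r; simpl; ring|].
  rewrite Nat.add_succ_r, !rpoch_S, IH, plus_INR. ring.
Qed.

Lemma rpoch_Sl a (n : nat) : rpoch a (S n) = a * rpoch (a + 1) n.
Proof. change (S n) with (1 + n)%nat. rewrite rpoch_add. simpl. ring. Qed.

(** A bound uniform in [n] allows comparison with the exponential series; 1/2 is the smallest lower
    parameter that occurs. *)
Lemma rpoch_lower a (n : nat) : 1 / 2 <= a -> 1 / 2 <= rpoch a n.
Proof.
  intros Ha. destruct n as [|n]; [simpl; lra|].
  rewrite rpoch_Sl. assert (1 <= rpoch (a + 1) n).
  { induction n as [|n IH]; [simpl; lra|]. rewrite rpoch_S. posnat. nra. }
  nra.
Qed.

Lemma fact_S (n : nat) : INR (fact (S n)) = (n + 1) * fact n.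
Proof. now rewrite fact_simpl, mult_INR, S_INR. Qed.

Lemma fact_pos (n : nat) : 0 < fact n.
Proof. apply INR_fact_lt_0. Qed.

(** Splitting the factorial into its factors of each parity turns the coefficients of cosine and
    sine into those of a 0F1 with lower parameter [1 / 2 + e]. *)
Lemma fact_parity (e k : nat) : (e = 0 \/ e = 1)%nat ->
  INR (fact (2 * k + e)) = 4 ^ k * fact k * rpoch (1 / 2 + e) k.
Proof.
  intros He. induction k as [|k IH].
  - destruct He as [-> | ->]; simpl; ring.
  - replace (2 * S k + e)%nat with (S (S (2 * k + e))) by lia.
    rewrite !fact_S, IH, rpoch_S, S_INR, plus_INR, mult_INR. simpl (4 ^ S k).
    change (INR 2) with 2. destruct He as [-> | ->]; simpl; field.
Qed.

Lemma is_series_0F1 (b x : R) : 1 / 2 <= b ->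
  is_series (fun r => x ^ r / (fact r * rpoch b r)) (Series (fun r => x ^ r / (fact r * rpoch b r))).
Proof.
  intros Hb. apply Series_correct.
  apply (ex_series_le (V := R_CompleteNormedModule) _ (fun r => 2 * (Rabs x ^ r / fact r))).
  - intros r. unfold norm; simpl; unfold abs; simpl.
    pose proof (rpoch_lower b r Hb) as H1. pose proof (fact_pos r) as H2.
    unfold Rdiv at 1. rewrite Rabs_mult, <- RPow_abs, Rabs_inv, Rabs_mult, !(Rabs_pos_eq (INR _)), (Rabs_pos_eq (rpoch b r)) by lra.
    unfold Rdiv. rewrite (Rmult_comm 2), !Rmult_assoc. apply Rmult_le_compat_l; [apply pow_le, Rabs_pos|].
    rewrite Rinv_mult. apply Rmult_le_compat_l; [left; now apply Rinv_0_lt_compat|].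
    replace 2 with (/ (1 / 2)) by field. apply Rinv_le_contravar; lra.
  - eexists. apply (is_series_scal (V := R_NormedModule) 2 (fun r => Rabs x ^ r / fact r)).
    apply is_series_exp.
Qed.

Lemma is_series_1F2 (a b x : R) : 0 < a -> 1 / 2 <= b ->
  is_series (fun r => x ^ r / (fact r * rpoch b r) * (a / (a + r)))
    (Series (fun r => x ^ r / (fact r * rpoch b r) * (a / (a + r)))).
Proof.
  intros Ha Hb. apply Series_correct.
  apply (ex_series_le (V := R_CompleteNormedModule) _ (fun r => Rabs x ^ r / (fact r * rpoch b r))).
  - intros r. unfold norm; simpl; unfold abs; simpl.
    pose proof (rpoch_lower b r Hb) as H1. pose proof (fact_pos r) as H2.
    assert (H3 : 0 <= a / (a + r) <= 1).
    { posnat. split; [left; apply Rdiv_lt_0_compat; lra|]. apply Rle_div_l; lra. }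
    set (q := a / (a + r)) in *. clearbody q.
    unfold Rdiv. rewrite !Rabs_mult, <- RPow_abs, Rabs_inv, Rabs_mult, !(Rabs_pos_eq (INR _)), (Rabs_pos_eq (rpoch b r)), (Rabs_pos_eq q) by lra.
    assert (0 <= Rabs x ^ r * / (fact r * rpoch b r)); [|nra].
    apply Rmult_le_pos; [apply pow_le, Rabs_pos | left; apply Rinv_0_lt_compat; nra].
  - eexists. apply is_series_0F1; exact Hb.
Qed.

Lemma is_series_tail (a : nat -> R) (n : nat) (l : R) :
  (forall k, (k < n)%nat -> a k = 0) -> is_series (fun r => a (n + r)%nat) l -> is_series a l.
Proof.
  intros Ha H. destruct n as [|n]; [exact H|].
  apply (is_series_decr_n (V := R_NormedModule) a (S n)); [lia|].
  assert (G : forall m, (m <= n)%nat -> sum_n a m = 0).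
  { induction m as [|m IH]; intros Hm; [rewrite sum_O; apply Ha; lia|].
    rewrite sum_Sn, IH, Ha by lia. unfold plus; simpl; ring. }
  match goal with |- is_series _ ?v => replace v with l; [exact H|] end.
  symmetry. etransitivity; [exact (f_equal (fun z => l + - z) (G n (le_n _)))|]. ring.
Qed.

(** In this form the factors [fact (n + r)] and [rpoch (1 / 2 + e) (n + r)] cancel against the
    denominator of the trigonometric coefficient of index [n + r]. *)
Lemma zprod_tail (e : R) (n r : nat) : 0 <= e ->
  zprod e (n + r)%nat n = fact (n + r) * rpoch (1 / 2 + e) (n + r) / (fact r * rpoch (1 / 2 + e) (2 * n + r)).
Proof.
  intros He. revert r. induction n as [|n IH]; intros r.
  - simpl. pose proof (fact_pos r). pose proof (rpoch_pos (1 / 2 + e) r ltac:(lra)). field. lra.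
  - rewrite zprod_S. replace (S n + r)%nat with (n + S r)%nat by lia. rewrite IH, fact_S.
    replace (2 * S n + r)%nat with (S (2 * n + S r)) by lia. rewrite rpoch_S.
    rewrite !plus_INR, mult_INR, S_INR. change (INR 2) with 2.
    pose proof (fact_pos r). pose proof (rpoch_pos (1 / 2 + e) (2 * n + S r) ltac:(lra)). posnat. field. lra.
Qed.

(** The terms with [j < n] vanish, and the shifted rest has its lower parameter raised by [2 * n].
    The function [h] carries whatever rational factor is left. *)
Lemma is_series_zprod (e : R) (n : nat) (x : R) (h : nat -> R) (s : R) : 0 <= e ->
  is_series (fun r => x ^ r / (fact r * rpoch (1 / 2 + e + 2 * n) r) * h (n + r)%nat) s ->
  is_series (fun j => x ^ j / (fact j * rpoch (1 / 2 + e) j) * (zprod e j n * h j)) (x ^ n / rpoch (1 / 2 + e) (2 * n) * s).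
Proof.
  intros He H. apply is_series_tail with n.
  { intros k Hk. rewrite zprod_nat_0 by exact Hk. ring. }
  apply (is_series_Rmult _ (x ^ n / rpoch (1 / 2 + e) (2 * n))) in H.
  refine (is_series_eq _ _ _ _ _ eq_refl H). intros r.
  rewrite zprod_tail by exact He. rewrite (rpoch_add _ (2 * n) r), pow_add, mult_INR. change (INR 2) with 2.
  pose proof (fact_pos r). pose proof (fact_pos (n + r)). pose proof (rpoch_pos (1 / 2 + e) (n + r) ltac:(lra)).
  pose proof (rpoch_pos (1 / 2 + e) (2 * n) ltac:(lra)).
  assert (0 < rpoch (1 / 2 + e + 2 * n) r) by (apply rpoch_pos; posnat; lra).
  field. lra.
Qed.

(** * Fourier transforms *)

Definition trig (e : nat) : R -> R := match e with O => cos | _ => sin end.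

Lemma is_series_trig (e : nat) (x : R) : (e = 0 \/ e = 1)%nat ->
  is_series (fun k => (-1) ^ k / fact (2 * k + e) * x ^ (2 * k + e)) (trig e x).
Proof.
  intros [-> | ->]; [|exact (is_series_sin x)].
  refine (is_series_eq _ _ _ _ _ eq_refl (is_series_cos x)).
  intros k. now rewrite Nat.add_0_r.
Qed.

Lemma trig_coef (e k : nat) (w : R) : (e = 0 \/ e = 1)%nat ->
  (-1) ^ k / fact (2 * k + e) * w ^ (2 * k + e) =
  w ^ e * ((- (w / 2) ^ 2) ^ k / (fact k * rpoch (1 / 2 + e) k)).
Proof.
  intros He. rewrite fact_parity, pow_add, pow_mult by exact He.
  replace (- (w / 2) ^ 2) with (-1 * (w ^ 2 * / 4)) by (simpl; field).
  rewrite !Rpow_mult_distr, pow_inv.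
  pose proof (fact_pos k). pose proof (rpoch_pos (1 / 2 + e) k ltac:(posnat; lra)).
  pose proof (pow_lt 4 k ltac:(lra)). field. lra.
Qed.

Lemma trig_0F1 (e : nat) (w : R) : (e = 0 \/ e = 1)%nat ->
  trig e w = w ^ e * Series (fun r => (- (w / 2) ^ 2) ^ r / (fact r * rpoch (1 / 2 + e) r)).
Proof.
  intros He.
  apply (is_series_uniq _ _ _ (is_series_trig e w He)).
  refine (is_series_eq _ _ _ _ _ eq_refl (is_series_Rmult _ (w ^ e) _ (is_series_0F1 (1 / 2 + e) (- (w / 2) ^ 2) _))).
  - intros k. symmetry. now apply trig_coef.
  - posnat; lra.
Qed.

Lemma continuous_trig (e : nat) (w t : R) : continuous (fun t => trig e (w * t)) t.
Proof.
  destruct e; simpl.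
  - apply (ex_derive_continuous (fun t => cos (w * t))). auto_derive; trivial.
  - apply (ex_derive_continuous (fun t => sin (w * t))). auto_derive; trivial.
Qed.

Lemma ex_mom (h g : R -> R) : (forall t, continuous h t) -> (forall t, continuous g t) -> exists I, mom h g I.
Proof.
  intros Ch Cg. apply (ex_RInt_continuous (V := R_CompleteNormedModule)). intros t _.
  apply (continuous_mult h g); auto.
Qed.

Lemma abs_pow_le_1 (t : R) (k : nat) : Rabs t <= 1 -> Rabs (t ^ k) <= 1.
Proof.
  intros Ht. rewrite <- RPow_abs. rewrite <- (pow1 k). apply pow_incr. split; [apply Rabs_pos | exact Ht].
Qed.

Lemma mom_trig (e : nat) (g : R -> R) (w s : R) (M : nat -> R) : (e = 0 \/ e = 1)%nat ->
  (forall t, continuous g t) ->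
  (forall j : nat, mom (fun t => t ^ (2 * j + e)) g (M j)) ->
  is_series (fun j => (- (w / 2) ^ 2) ^ j / (fact j * rpoch (1 / 2 + e) j) * M j) s ->
  mom (fun t => trig e (w * t)) g (w ^ e * s).
Proof.
  intros He Cg HM Hs.
  destruct (ex_mom (fun t => trig e (w * t)) g (continuous_trig e w) Cg) as [I HI].
  replace (w ^ e * s) with I; [exact HI|].
  set (b := fun k => w ^ e * ((- (w / 2) ^ 2) ^ k / (fact k * rpoch (1 / 2 + e) k))).
  apply (is_series_uniq (fun k => b k * M k)).
  - apply (is_series_mom (fun k t => t ^ (2 * k + e)) (fun t => trig e (w * t)) g); trivial.
    + intros k t Ht. apply abs_pow_le_1. now apply Rabs_le.
    + eexists. refine (is_series_eq (fun k => Rabs (w ^ e) * (((w / 2) ^ 2) ^ k / (fact k * rpoch (1 / 2 + e) k))) _ _ _ _ eq_refl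
        (is_series_Rmult _ _ _ (is_series_0F1 (1 / 2 + e) ((w / 2) ^ 2) _))).
      * intros k. unfold b.
        pose proof (fact_pos k). pose proof (rpoch_pos (1 / 2 + e) k ltac:(posnat; lra)).
        unfold Rdiv. rewrite !Rabs_mult, Rabs_inv, Rabs_mult, (Rabs_pos_eq (INR _)), (Rabs_pos_eq (rpoch _ _)) by lra.
        rewrite <- !RPow_abs, Rabs_Ropp, (Rabs_pos_eq (_ ^ 2)) by apply pow2_ge_0. reflexivity.
      * posnat; lra.
    + intros t _. refine (is_series_eq _ _ _ _ _ eq_refl (is_series_trig e (w * t) He)).
      intros k. unfold b. rewrite <- trig_coef, Rpow_mult_distr by exact He. ring.
  - refine (is_series_eq _ _ _ _ _ eq_refl (is_series_Rmult _ (w ^ e) _ Hs)).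
    intros k. unfold b. ring.
Qed.

Lemma is_series_zero : is_series (fun _ : nat => 0) 0.
Proof.
  apply (is_series_tail _ 0). { intros; reflexivity. }
  refine (is_series_eq _ _ _ _ _ _ (is_series_Rmult _ 0 _ (is_series_exp 0))).
  - intros k. cbv beta. ring.
  - ring.
Qed.

Lemma mom_trig_0 (e : nat) (g : R -> R) (w : R) : (e = 0 \/ e = 1)%nat ->
  (forall t, continuous g t) ->
  (forall j : nat, mom (fun t => t ^ (2 * j + e)) g 0) ->
  mom (fun t => trig e (w * t)) g 0.
Proof.
  intros He Cg H0. rewrite <- (Rmult_0_r (w ^ e)).
  apply mom_trig with (M := fun _ => 0); trivial.
  refine (is_series_eq _ _ _ _ _ eq_refl is_series_zero). intros k. ring.
Qed.

Lemma fourier_eq (f g : R -> R) (w c s : R) :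
  (forall t, -1 < t < 1 -> f t = g t) ->
  mom (fun t => trig 0 (w * t)) g c -> mom (fun t => trig 1 (w * t)) g s ->
  fourier f w = (c, - s).
Proof.
  intros E Hc Hs. unfold fourier. apply (is_RInt_unique (V := C_R_CompleteNormedModule)).
  apply (is_RInt_fct_extend_pair (U := R_NormedModule) (V := R_NormedModule)).
  - refine (is_RInt_ext _ _ _ _ _ _ Hc).
    rewrite Rmin_left, Rmax_right by lra. intros t Ht. rewrite E by exact Ht.
    unfold Cexp, Cmult, Copp, Ci, RtoC, Re, Im; simpl.
    replace (- ((0 * w - 1 * 0) * t - (0 * 0 + 1 * w) * 0)) with 0 by ring.
    replace (- ((0 * w - 1 * 0) * 0 + (0 * 0 + 1 * w) * t)) with (- (w * t)) by ring.
    rewrite exp_0, cos_neg. ring.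
  - replace (- s) with (opp s) by reflexivity.
    refine (is_RInt_ext _ _ _ _ _ _ (is_RInt_opp (V := R_NormedModule) _ _ _ _ Hs)).
    rewrite Rmin_left, Rmax_right by lra. intros t Ht. rewrite E by exact Ht.
    unfold Cexp, Cmult, Copp, Ci, RtoC, Re, Im; simpl.
    replace (- ((0 * w - 1 * 0) * t - (0 * 0 + 1 * w) * 0)) with 0 by ring.
    replace (- ((0 * w - 1 * 0) * 0 + (0 * 0 + 1 * w) * t)) with (- (w * t)) by ring.
    rewrite exp_0, sin_neg, cos_neg. unfold opp; simpl. ring.
Qed.

(** Only the cosine part ([e = 0]) or only the sine part ([e = 1]) survives; the prefactor combines
    the [w ^ e] of its series with the constant 1 or [- Ci]. *)
Lemma fourier_parity (e : nat) (f g : R -> R) (w s : R) (M : nat -> R) : (e = 0 \/ e = 1)%nat ->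
  (forall t, continuous g t) -> (forall t, -1 < t < 1 -> f t = g t) ->
  (forall j : nat, mom (fun t => t ^ (2 * j + e)) g (M j)) ->
  (forall j : nat, mom (fun t => t ^ (2 * j + (1 - e))) g 0) ->
  is_series (fun j => (- (w / 2) ^ 2) ^ j / (fact j * rpoch (1 / 2 + e) j) * M j) s ->
  fourier f w = ((- (Ci * w)) ^ e * s)%C.
Proof.
  intros He Cg E HM H0 Hs.
  pose proof (mom_trig e g w s M He Cg HM Hs) as H1.
  pose proof (mom_trig_0 (1 - e) g w ltac:(lia) Cg H0) as H2.
  destruct He as [-> | ->]; simpl (1 - _)%nat in H2.
  - rewrite (fourier_eq _ _ _ _ _ E H1 H2). simpl.
    unfold Cmult, RtoC; simpl. f_equal; ring.
  - rewrite (fourier_eq _ _ _ _ _ E H2 H1). simpl.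
    unfold Cmult, Copp, Ci, RtoC; simpl. f_equal; ring.
Qed.

Lemma continuous_psi (n : nat) t : continuous (psi n) t.
Proof. destruct (vanishing_psi n) as [D _]. eapply continuous_deg; exact D. Qed.

Lemma continuous_lin (f g : R -> R) (c d t : R) : continuous f t -> continuous g t ->
  continuous (fun t => c * f t + d * g t) t.
Proof.
  intros Hf Hg. apply (continuous_plus (V := R_NormedModule) (fun t => c * f t) (fun t => d * g t)).
  - apply (continuous_scal_r (V := R_NormedModule) c f t Hf).
  - apply (continuous_scal_r (V := R_NormedModule) d g t Hg).
Qed.

Lemma continuous_u_res (e m n : nat) t : (e = 0 \/ e = 1)%nat -> continuous (u_res e m n) t.
Proof.
  intros He. induction n as [|n IH]; [now apply continuous_ubar|].
  apply continuous_ext with (2 := continuous_lin _ _ 1 (- ((u_const e m n - u_const e m (S n)) / psi_const (2 * n + e))) t IH (continuous_psi (2 * n + e) t)).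
  intros x. cbn [u_res]. match goal with |- ?a = ?b => change (@eq R a b) end. ring.
Qed.

Lemma continuous_r0_res (n : nat) t : continuous (r0_res n) t.
Proof.
  induction n as [|n IH].
  - apply (ex_derive_continuous (fun t => 1 + t)). auto_derive; trivial.
  - apply continuous_ext with (2 := continuous_lin _ _ 1 (- (8 / psi_const n * (1 / ((n + 1) * (n + 3)) - 1 / ((n + 2) * (n + 4))))) t IH (continuous_psi n t)).
    intros x. cbn [r0_res]. match goal with |- ?a = ?b => change (@eq R a b) end. ring.
Qed.

Lemma rpoch_ratio (a : R) (r : nat) : 0 < a -> rpoch a r / rpoch (a + 1) r = a / (a + r).
Proof.
  intros Ha. pose proof (rpoch_pos a r Ha). pose proof (rpoch_pos (a + 1) r ltac:(lra)).
  pose proof (rpoch_Sl a r) as E. rewrite rpoch_S in E. posnat.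
  apply (Rmult_eq_reg_r (rpoch (a + 1) r * (a + r))); [|nra].
  transitivity (rpoch a r * (a + r)); [field; lra|]. rewrite E. field. lra.
Qed.

(* 0F1(-; b; x), and 1F2(a; a+1, b; x) with (a)_r / (a+1)_r written as a / (a+r). *)
Definition hyp01 (b x : R) : R := Series (fun r => x ^ r / (fact r * rpoch b r)).
Definition hyp12 (a b x : R) : R := Series (fun r => x ^ r / (fact r * rpoch b r) * (a / (a + r))).

Lemma series_1 (e : nat) (x : R) :
  is_series (fun j => x ^ j / (fact j * rpoch (1 / 2 + e) j) * 1) (hyp01 (1 / 2 + e) x).
Proof.
  refine (is_series_eq _ _ _ _ _ eq_refl (is_series_0F1 (1 / 2 + e) x _)); [intros; ring | posnat; lra].
Qed.

Lemma series_zprod (e n : nat) (x : R) :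
  is_series (fun j => x ^ j / (fact j * rpoch (1 / 2 + e) j) * (zprod e j n * 1))
    (x ^ n / rpoch (1 / 2 + e) (2 * n) * hyp01 (1 / 2 + e + 2 * n) x).
Proof.
  apply is_series_zprod; [apply pos_INR|].
  refine (is_series_eq _ _ _ _ _ eq_refl (is_series_0F1 (1 / 2 + e + 2 * n) x _)); [intros; ring | posnat; lra].
Qed.

(** The shift [j = n + r] moves the pole to [1 / (a + r)], which up to the factor [a] is the
    quotient of the Pochhammer symbols of [a] and [a + 1]. *)
Lemma series_zprod_pole (e n : nat) (a x : R) : 0 < a ->
  is_series (fun j => x ^ j / (fact j * rpoch (1 / 2 + e) j) * (zprod e j n * (1 / (j - n + a))))
    (x ^ n / rpoch (1 / 2 + e) (2 * n) * (hyp12 a (1 / 2 + e + 2 * n) x / a)).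
Proof.
  intros Ha. apply (is_series_zprod _ _ _ (fun j => 1 / (j - n + a))); [apply pos_INR|].
  refine (is_series_eq _ _ _ _ _ _ (is_series_Rmult _ (/ a) _ (is_series_1F2 a (1 / 2 + e + 2 * n) x Ha _)));
    [intros r| unfold hyp12; field; lra | posnat; lra].
  rewrite plus_INR. pose proof (fact_pos r).
  pose proof (rpoch_pos (1 / 2 + e + 2 * n) r ltac:(posnat; lra)). posnat. field. lra.
Qed.

(** This pole is the next denominator of [zprod]: after the shift it is [b + r] for the lower
    parameter [b = 1 / 2 + e + 2 * n], so it merely raises [b] by one and the series remains a
    0F1. *)
Lemma series_Y (e n : nat) (x : R) :
  is_series (fun j => x ^ j / (fact j * rpoch (1 / 2 + e) j) * (zprod e j n * (1 / (j + n + 1 / 2 + e))))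
    (x ^ n / rpoch (1 / 2 + e) (2 * n + 1) * hyp01 (3 / 2 + e + 2 * n) x).
Proof.
  replace (x ^ n / rpoch (1 / 2 + e) (2 * n + 1) * hyp01 (3 / 2 + e + 2 * n) x) with
    (x ^ n / rpoch (1 / 2 + e) (2 * n) * (hyp01 (3 / 2 + e + 2 * n) x / (1 / 2 + e + 2 * n))).
  - apply (is_series_zprod _ _ _ (fun j => 1 / (j + n + 1 / 2 + e))); [apply pos_INR|].
    refine (is_series_eq _ _ _ _ _ _ (is_series_Rmult _ (/ (1 / 2 + e + 2 * n)) _ (is_series_0F1 (3 / 2 + e + 2 * n) x _)));
    [intros r| unfold hyp01; field; posnat; lra | posnat; lra].
    replace (3 / 2 + e + 2 * n) with (1 / 2 + e + 2 * n + 1) by field.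
    pose proof (rpoch_ratio (1 / 2 + e + 2 * n) r ltac:(posnat; lra)) as E.
    pose proof (fact_pos r). pose proof (rpoch_pos (1 / 2 + e + 2 * n) r ltac:(posnat; lra)) as P1.
    pose proof (rpoch_pos (1 / 2 + e + 2 * n + 1) r ltac:(posnat; lra)) as P2.
    rewrite plus_INR. set (p := rpoch (1 / 2 + e + 2 * n) r) in *. set (q := rpoch (1 / 2 + e + 2 * n + 1) r) in *.
    assert (E' : 1 / q = (1 / 2 + e + 2 * n) / (1 / 2 + e + 2 * n + r) / p).
    { rewrite <- E. field. lra. }
    transitivity (/ (1 / 2 + e + 2 * n) * x ^ r / fact r * (1 / q)); [field; posnat; lra|].
    rewrite E'. field. posnat; lra.
  - rewrite rpoch_add, mult_INR. change (INR 2) with 2. simpl (rpoch (_ + _) 1).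
    pose proof (rpoch_pos (1 / 2 + e) (2 * n) ltac:(posnat; lra)). posnat. field. lra.
Qed.

(** * Transfer from real to complex expressions *)

(** Both inverses send 0 to 0; without a side condition, [push_RtoC] can rewrite quotients
    unconditionally. *)
Lemma RtoC_inv_total (x : R) : RtoC (/ x) = (/ RtoC x)%C.
Proof.
  destruct (Req_dec x 0) as [->|Hx]; [|now apply RtoC_inv].
  unfold Cinv, RtoC; simpl. rewrite Rinv_0. f_equal; unfold Rdiv; ring.
Qed.

Lemma RtoC_div_total (x y : R) : RtoC (x / y) = (RtoC x / RtoC y)%C.
Proof. unfold Rdiv, Cdiv. now rewrite RtoC_mult, RtoC_inv_total. Qed.

Ltac push_RtoC :=
  repeat progress rewrite ?RtoC_plus, ?RtoC_minus, ?RtoC_mult, ?RtoC_div_total, ?RtoC_opp, ?RtoC_pow.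

Lemma poch_RtoC (a : R) (n : nat) : poch (RtoC a) n = RtoC (rpoch a n).
Proof. induction n as [|n IH]; [reflexivity|]. simpl. rewrite IH. now push_RtoC. Qed.

Lemma CSeries_RtoC (a : nat -> C) (b : nat -> R) : (forall k, a k = RtoC (b k)) -> CSeries a = RtoC (Series b).
Proof.
  intros E. unfold CSeries, RtoC. f_equal.
  - apply Series_ext. intros k. now rewrite E.
  - rewrite (Series_ext _ (fun _ => 0)); [apply is_series_unique, is_series_zero|].
    intros k. now rewrite E.
Qed.

Lemma pFq_hyp01 (b x : R) : pFq [] [RtoC b] (RtoC x) = RtoC (hyp01 b x).
Proof.
  apply CSeries_RtoC. intros k. simpl. rewrite poch_RtoC. push_RtoC. unfold Cdiv.
  rewrite Cmult_1_l, Cmult_1_r, (Cmult_comm (RtoC (rpoch b k))). apply Cmult_comm.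
Qed.

Lemma pFq_hyp12 (a b x : R) : 0 < a -> 0 < b ->
  pFq [RtoC a] [RtoC (a + 1); RtoC b] (RtoC x) = RtoC (hyp12 a b x).
Proof.
  intros Ha Hb. apply CSeries_RtoC. intros k. simpl. rewrite !poch_RtoC.
  rewrite <- rpoch_ratio by exact Ha. rewrite !Cmult_1_r.
  rewrite <- !RtoC_mult, <- RtoC_div_total, <- RtoC_pow, <- RtoC_mult. f_equal.
  pose proof (fact_pos k). pose proof (rpoch_pos a k Ha). pose proof (rpoch_pos (a + 1) k ltac:(lra)).
  pose proof (rpoch_pos b k Hb). field. lra.
Qed.

(** * Closed forms of the constants and the moments behind the transform of [l0] *)

Lemma psi_const_closed (n e : nat) : (e = 0 \/ e = 1)%nat ->
  psi_const (2 * n + e) = fact n / rpoch (n + 1 / 2 + e) (n + 2).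
Proof.
  assert (H : psi_const (2 * n) = fact n / rpoch (n + 1 / 2) (n + 2) /\ psi_const (2 * n + 1) = fact n / rpoch (n + 3 / 2) (n + 2)).
  { assert (St : forall n, psi_const (2 * n) = fact n / rpoch (n + 1 / 2) (n + 2) -> psi_const (2 * n + 1) = fact n / rpoch (n + 3 / 2) (n + 2)).
    { clear n. intros n H. replace (2 * n + 1)%nat with (S (2 * n)) by lia. rewrite psi_const_S, H.
      replace (n + 2)%nat with (S (n + 1)) by lia.
      rewrite (rpoch_S (n + 3 / 2)), (rpoch_Sl (n + 1 / 2)).
      replace (n + 1 / 2 + 1) with (n + 3 / 2) by field.
      rewrite mult_INR, plus_INR. simpl.
      pose proof (rpoch_pos (n + 3 / 2) (n + 1) ltac:(posnat; lra)). posnat. field. lra. }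
    induction n as [|n [IH0 IH1]].
    - assert (A0 : psi_const (2 * 0) = fact 0 / rpoch (0%nat + 1 / 2) (0 + 2)) by (simpl; field).
      split; [exact A0 | apply (St 0%nat A0)].
    - enough (A0 : psi_const (2 * S n) = fact (S n) / rpoch (S n + 1 / 2) (S n + 2)) by (split; [exact A0 | now apply St]).
      replace (2 * S n)%nat with (S (2 * n + 1)) by lia. rewrite psi_const_S, IH1, fact_S.
      replace (S n + 2)%nat with (S (n + 2)) by lia.
      rewrite rpoch_S, S_INR. replace (n + 1 + 1 / 2) with (n + 3 / 2) by field.
      rewrite !plus_INR, mult_INR. simpl.
      pose proof (rpoch_pos (n + 3 / 2) (n + 2) ltac:(posnat; lra)). posnat. field. lra. }
  intros [-> | ->].
  - rewrite Nat.add_0_r. change (INR 0) with 0. rewrite Rplus_0_r. apply H.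
  - change (INR 1) with 1. replace (n + 1 / 2 + 1) with (n + 3 / 2) by field. apply H.
Qed.

(** The factors [(n + 1) / (n + 2)] and [(n + 1 / 2 + e) / (n + 3 / 2 + e)] of the recursion
    telescope; the initial [m + 1 / 2] supplies the first factor of the Pochhammer symbol of
    [- m - 1 / 2], up to sign. *)
Lemma u_const_closed (e m n : nat) :
  u_const e m n = - ((-1) ^ n * rpoch (- m - 1 / 2) (n + 1)) / (rpoch (m + 1 + e) (n + 1) * (n + 1) * (1 / 2 + e + n)).
Proof.
  induction n as [|n IH].
  - simpl. posnat. field. lra.
  - cbn [u_const]. rewrite IH. replace (S n + 1)%nat with (S (n + 1)) by lia.
    rewrite !rpoch_S, plus_INR. change (INR 1) with 1. rewrite !S_INR. simpl ((-1) ^ S n).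
    pose proof (rpoch_pos (m + 1 + e) (n + 1) ltac:(posnat; lra)). posnat. field. lra.
Qed.

Lemma pow_x (w : R) (k : nat) : (- (w / 2) ^ 2) ^ k = (-1) ^ k * (w / 2) ^ (2 * k).
Proof. rewrite pow_opp. now rewrite pow_mult. Qed.

Lemma trig_cos (e : nat) (w : R) : (e = 0 \/ e = 1)%nat -> cos (w - e * (PI / 2)) = trig e w.
Proof.
  intros [-> | ->]; simpl.
  - f_equal. ring.
  - rewrite <- cos_shift, <- cos_neg. f_equal. ring.
Qed.

Lemma mom_reflect (h f : R -> R) v : mom h f v -> mom (fun t => h (- t)) (fun t => f (- t)) v.
Proof.
  intros H. unfold mom in *.
  pose proof (is_RInt_comp_opp (V := R_NormedModule) (fun t => h t * f t) 1 (-1) v) as H1.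
  replace (- (-1)) with 1 in H1 by ring. replace (- (1)) with (-1) in H1 by ring.
  specialize (H1 H). apply is_RInt_swap, (is_RInt_opp (V := R_NormedModule)) in H1.
  match type of H1 with is_RInt _ _ _ ?z => replace v with z by (unfold opp; simpl; ring) end.
  refine (is_RInt_ext _ _ _ _ _ _ H1). intros t _. unfold opp; simpl. ring.
Qed.

Lemma fourier_l0_pair (n : nat) (w c s : R) :
  mom (fun t => trig 0 (w * t)) (r0_res n) c -> mom (fun t => trig 1 (w * t)) (r0_res n) s ->
  fourier (l0 (n + 1)) w = (c, s).
Proof.
  (* Two signs cancel: the reflection negates the sine moment, and [fourier_eq] negates it again. *)
  intros Hc Hs. replace s with (- - s) by ring.
  apply fourier_eq with (g := fun t => r0_res n (- t)).
  - intros t Ht. unfold l0. apply r0_eq_res. lra.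
  - apply mom_reflect in Hc. refine (mom_weight _ _ _ _ _ Hc). intros t. cbv beta.
    simpl. rewrite <- (cos_neg (w * t)). f_equal. ring.
  - apply mom_reflect in Hs. pose proof (mom_lin _ _ _ _ _ (-1) 0 Hs Hs) as K.
    replace (- s) with (-1 * s + 0 * s) by ring. refine (mom_conv _ _ _ _ _ _ K). intros t.
    simpl. replace (w * - t) with (- (w * t)) by ring. rewrite sin_neg. ring.
Qed.

Lemma mom_trig_r0_moment (e n : nat) (g : R -> R) (w : R) : (e = 0 \/ e = 1)%nat ->
  (forall t, continuous g t) ->
  (forall j : nat, mom (fun t => t ^ (2 * j + e)) g (r0_moment e n j)) ->
  mom (fun t => trig e (w * t)) g
    (/ ((n + 1) * (n + 1 / 2 + e)) * (trig e w -
      w ^ e * (-1) ^ S n * (w / 2) ^ (2 * S n) / rpoch (1 / 2 + e) (2 * S n) * hyp01 (1 / 2 + e + 2 * S n) (- (w / 2) ^ 2))).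
Proof.
  intros He Cg HM. set (x := - (w / 2) ^ 2).
  rewrite trig_0F1 by exact He. fold x. fold (hyp01 (1 / 2 + e) x).
  replace (/ _ * _) with (w ^ e * (/ ((n + 1) * (n + 1 / 2 + e)) * (hyp01 (1 / 2 + e) x -
      x ^ S n / rpoch (1 / 2 + e) (2 * S n) * hyp01 (1 / 2 + e + 2 * S n) x))).
  2: { unfold x at 2. rewrite pow_x. unfold Rdiv. ring. }
  apply mom_trig with (M := r0_moment e n); [exact He | exact Cg | exact HM|].
  refine (is_series_eq _ _ _ _ _ _ (is_series_Rmult _ (/ ((n + 1) * (n + 1 / 2 + e))) _
      (is_series_lin _ _ 1 (-1) _ _ (series_1 e x) (series_zprod e (S n) x)))); [intros j | ring].
  unfold r0_moment. fold x. ring.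
Qed.

(** Among [psi 0, ..., psi (n - 1)] there are [Nat.div2 (n + 1)] of even and [Nat.div2 n] of odd
    index. *)
Lemma r0_res_parity_moments (n j : nat) :
  mom (fun t => t ^ (2 * j + 0)) (r0_res n) (r0_moment 0 (Nat.div2 (n + 1)) j) /\
  mom (fun t => t ^ (2 * j + 1)) (r0_res n) (r0_moment 1 (Nat.div2 n) j).
Proof.
  rewrite Nat.add_0_r. destruct (nat_parity n) as [i [-> | ->]].
  - rewrite Nat.add_1_r, Nat.div2_succ_double, Nat.div2_double. exact (proj1 (r0_res_moments i j)).
  - replace (Nat.div2 (2 * i + 1 + 1)) with (S i)
      by (replace (2 * i + 1 + 1)%nat with (2 * S i)%nat by lia; now rewrite Nat.div2_double).
    replace (Nat.div2 (2 * i + 1)) with i by (now rewrite Nat.add_1_r, Nat.div2_succ_double).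
    exact (proj2 (r0_res_moments i j)).
Qed.

(** * Complex series and moments about -1 *)

(** The 2F2 has the imaginary argument [2 * Ci * w], so it does not reduce to one real series;
    [CSeries] alone carries no convergence, which linear combinations require. *)
Definition is_CSeries (a : nat -> C) (l : C) : Prop :=
  is_series (fun k => Re (a k)) (Re l) /\ is_series (fun k => Im (a k)) (Im l).

Lemma is_CSeries_unique (a : nat -> C) (l : C) : is_CSeries a l -> CSeries a = l.
Proof.
  intros [H1 H2]. unfold CSeries. rewrite (is_series_unique _ _ H1), (is_series_unique _ _ H2).
  now destruct l.
Qed.

Lemma is_CSeries_ext (a b : nat -> C) (l : C) : (forall k, a k = b k) -> is_CSeries a l -> is_CSeries b l.
Proof.
  intros E [H1 H2].
  split; [refine (is_series_ext _ _ _ _ H1) | refine (is_series_ext _ _ _ _ H2)]; intros k; now rewrite E.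
Qed.

Lemma is_CSeries_mult (a : nat -> C) (c l : C) : is_CSeries a l -> is_CSeries (fun k => (c * a k)%C) (c * l)%C.
Proof.
  intros [H1 H2]. split.
  - refine (is_series_eq _ _ _ _ _ _ (is_series_lin _ _ (Re c) (- Im c) _ _ H1 H2)).
    + intros k. rewrite re_mult. ring.
    + rewrite re_mult. ring.
  - refine (is_series_eq _ _ _ _ _ _ (is_series_lin _ _ (Re c) (Im c) _ _ H2 H1)).
    + intros k. rewrite im_mult. ring.
    + rewrite im_mult. ring.
Qed.

Lemma is_CSeries_plus (a b : nat -> C) (la lb : C) : is_CSeries a la -> is_CSeries b lb ->
  is_CSeries (fun k => (a k + b k)%C) (la + lb)%C.
Proof.
  intros [H1 H2] [H3 H4]. split.
  - refine (is_series_eq _ _ _ _ _ _ (is_series_lin _ _ 1 1 _ _ H1 H3)); [intros k|]; unfold Re, Cplus; simpl; ring.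
  - refine (is_series_eq _ _ _ _ _ _ (is_series_lin _ _ 1 1 _ _ H2 H4)); [intros k|]; unfold Im, Cplus; simpl; ring.
Qed.

(** Made for [uprod], which vanishes at [1, ..., n] but not at 0: the isolated term of index 0
    produces the summand with [Cexp (- (Ci * w))] alone. *)
Lemma is_series_drop (a : nat -> R) (n : nat) (l : R) :
  (forall k, (1 <= k <= n)%nat -> a k = 0) -> is_series a l -> is_series (fun r => a (S n + r)%nat) (l - a 0%nat).
Proof.
  intros Ha H. apply (is_series_incr_n (V := R_NormedModule) a (S n)); [lia|].
  assert (G : forall m, (m <= n)%nat -> sum_n a m = a 0%nat).
  { induction m as [|m IH]; intros Hm; [apply sum_O|].
    rewrite sum_Sn, IH, (Ha (S m)) by lia. unfold plus; simpl; ring. }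
  match goal with |- is_series _ ?v => replace v with l; [exact H|] end.
  symmetry. etransitivity; [exact (f_equal (fun z => l - a 0%nat + z) (G n (le_n _)))|]. ring.
Qed.

Lemma is_CSeries_drop (a : nat -> C) (n : nat) (l : C) :
  (forall k, (1 <= k <= n)%nat -> a k = RtoC 0) -> is_CSeries a l ->
  is_CSeries (fun r => a (S n + r)%nat) (l - a 0%nat)%C.
Proof.
  intros Ha [H1 H2]. split.
  - refine (is_series_drop (fun k => Re (a k)) n _ _ H1). intros k Hk. now rewrite Ha.
  - refine (is_series_drop (fun k => Im (a k)) n _ _ H2). intros k Hk. now rewrite Ha.
Qed.

(** No separate convergence proof for [a] is required: it follows from the scaled series if [c] is
    nonzero, and otherwise both sides are 0. The second case is met at [w = 0]. *)
Lemma is_CSeries_factor (a : nat -> C) (c l : C) : is_CSeries (fun k => (c * a k)%C) l -> (c * CSeries a)%C = l.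
Proof.
  intros H. destruct (Ceq_dec c (RtoC 0)) as [->|Hc].
  - rewrite Cmult_0_l. rewrite <- (is_CSeries_unique _ _ H).
    rewrite (CSeries_RtoC _ (fun _ => 0)) by (intros; apply Cmult_0_l).
    now rewrite (is_series_unique _ _ is_series_zero).
  - apply (is_CSeries_mult _ (/ c)%C) in H.
    assert (E : CSeries a = (/ c * l)%C).
    { apply is_CSeries_unique. refine (is_CSeries_ext _ _ _ _ H). intros k. now field. }
    rewrite E. now field.
Qed.

Lemma Ci_pow_parity (e k : nat) (x : R) : (e = 0 \/ e = 1)%nat ->
  ((Ci * x) ^ (2 * k + e) = Ci ^ e * RtoC ((-1) ^ k * x ^ (2 * k + e)))%C.
Proof.
  intros He. rewrite Cpow_mult_l, (RtoC_mult _ (x ^ _)), !RtoC_pow, Cmult_assoc. f_equal.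
  rewrite Cpow_add_r, Cpow_mult_r. rewrite Cmult_comm. f_equal.
  replace (Ci ^ 2)%C with (RtoC (-1)) by (unfold Ci, RtoC, Cpow, Cmult; simpl; f_equal; ring).
  reflexivity.
Qed.

Lemma is_pseries_1 (b : nat -> R) (y l : R) : y = 1 -> is_pseries b y l <-> is_series b l.
Proof.
  intros ->.
  assert (E : forall k, scal (pow_n 1 k : R) (b k) = b k).
  { intros k. rewrite pow_n_pow, pow1. apply Rmult_1_l. }
  split; intros H; [refine (is_series_ext _ _ _ _ H) | refine (is_series_ext _ _ _ _ H)]; intros k; auto.
Qed.

Lemma is_CSeries_exp (x : R) : is_CSeries (fun k => ((Ci * x) ^ k / fact k)%C) (cos x, sin x).
Proof.
  (* [p] stands for [Re] or [Im]; real homogeneity is all that the splitting into even and odd terms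
     uses. *)
  assert (P : forall (p : C -> R), (forall (z : C) (r : R), p (z * r)%C = p z * r) ->
    is_series (fun k => p ((Ci * x) ^ k / fact k)%C) (p (RtoC 1) * cos x + p Ci * sin x)).
  { intros p Hp.
    assert (Q : forall k (e : nat), (e = 0 \/ e = 1)%nat -> p ((Ci * x) ^ (2 * k + e) / fact (2 * k + e))%C
       = p (Ci ^ e)%C * ((-1) ^ k / fact (2 * k + e) * x ^ (2 * k + e))).
    { intros k e He. rewrite Ci_pow_parity by exact He. unfold Cdiv.
      rewrite <- Cmult_assoc, <- RtoC_inv_total, <- RtoC_mult, Hp. field. apply INR_fact_neq_0. }
    set (a := fun k => p ((Ci * x) ^ k / fact k)%C).
    pose proof (is_pseries_odd_even a 1 (p (RtoC 1) * cos x) (p Ci * sin x)) as H.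
    replace (p (RtoC 1) * cos x + p Ci * sin x) with (p (RtoC 1) * cos x + 1 * (p Ci * sin x)) by ring.
    apply (is_pseries_1 a 1); [reflexivity|]. apply H; (apply is_pseries_1; [ring|]).
    - refine (is_series_eq _ _ _ _ _ eq_refl (is_series_Rmult _ (p (RtoC 1)) _ (is_series_trig 0 x (or_introl eq_refl)))).
      intros k. symmetry. specialize (Q k 0%nat (or_introl eq_refl)).
      transitivity (a (2 * k + 0)%nat); [now rewrite Nat.add_0_r | exact Q].
    - refine (is_series_eq _ _ _ _ _ eq_refl (is_series_Rmult _ (p Ci) _ (is_series_trig 1 x (or_intror eq_refl)))).
      intros k. symmetry. specialize (Q k 1%nat (or_intror eq_refl)). rewrite Cpow_1_r in Q. exact Q. }
  split.
  - pose proof (P Re ltac:(intros; apply re_scal_r)) as H. simpl in H. simpl.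
    replace (cos x) with (1 * cos x + 0 * sin x) by ring. exact H.
  - pose proof (P Im ltac:(intros; apply im_scal_r)) as H. simpl in H. simpl.
    replace (sin x) with (0 * cos x + 1 * sin x) by ring. exact H.
Qed.

Lemma uprod_0 (n : nat) : uprod 0 n = (-1) ^ n / (n + 1).
Proof.
  induction n as [|n IH]; [simpl; field|]. rewrite uprod_S, IH, S_INR. posnat. simpl. field. lra.
Qed.

Lemma uprod_zero (k n : nat) : (1 <= k <= n)%nat -> uprod k n = 0.
Proof.
  induction n as [|n IH]; [lia|]. intros Hk. rewrite uprod_S.
  destruct (Nat.eq_dec k (S n)) as [->|Hn].
  - rewrite S_INR. unfold Rdiv. ring.
  - rewrite IH by lia. ring.
Qed.

Lemma uprod_tail (n r : nat) : uprod (S n + r)%nat n = fact (n + r) * fact (n + 2 + r) / (fact r * fact (2 * n + 2 + r)).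
Proof.
  revert r. induction n as [|n IH]; intros r.
  - simpl. pose proof (fact_pos r). pose proof (fact_pos (S (S r))). simpl in *. field. lra.
  - rewrite uprod_S. replace (S (S n) + r)%nat with (S n + S r)%nat by lia. rewrite IH.
    replace (S n + r)%nat with (n + S r)%nat by lia. replace (S n + 2 + r)%nat with (n + 2 + S r)%nat by lia.
    replace (2 * S n + 2 + r)%nat with (S (2 * n + 2 + S r)) by lia.
    rewrite (fact_S r), (fact_S (2 * n + 2 + S r)), !plus_INR, mult_INR, !S_INR.
    pose proof (fact_pos r). pose proof (fact_pos (2 * n + 2 + S r)). change (INR 0) with 0. posnat. field. lra.
Qed.

Lemma rpoch_fact (n r : nat) : rpoch (n + 1) r = fact (n + r) / fact n.
Proof.
  induction r as [|r IH].
  - rewrite Nat.add_0_r. simpl. field. apply INR_fact_neq_0.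
  - rewrite rpoch_S, IH, Nat.add_succ_r, fact_S, plus_INR. field. apply INR_fact_neq_0.
Qed.

Lemma Cmod_Ci : Cmod Ci = 1.
Proof.
  unfold Cmod, Ci; simpl. replace (0 * (0 * 1) + 1 * (1 * 1)) with 1 by ring. apply sqrt_1.
Qed.

Lemma mom_comb (h k f : R -> R) a b c d :
  mom h f a -> mom k f b -> mom (fun t => c * h t + d * k t) f (c * a + d * b).
Proof.
  intros Ha Hb.
  assert (S : forall h v, mom h f v -> mom f h v) by (intros g v H; refine (mom_conv _ _ _ _ _ _ H); intros; ring).
  apply S in Ha, Hb. pose proof (mom_lin _ _ _ _ _ c d Ha Hb) as H.
  refine (mom_conv _ _ _ _ _ _ H). intros; ring.
Qed.

Lemma mom_exp_shifted (n : nat) (w c s : R) :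
  mom (fun t => cos (w * (1 + t))) (r0_res n) c -> mom (fun t => sin (w * (1 + t))) (r0_res n) s ->
  is_CSeries (fun k => ((Ci * (2 * w)%R) ^ k / fact k * RtoC (4 / ((n + 1) * (n + 3)) * (1 - uprod k (S n))))%C) (c, s).
Proof.
  intros Hc Hs.
  assert (P : forall (p : C -> R) (f : R -> R) (I : R), (forall (z : C) (r : R), p (z * r)%C = p z * r) ->
    (forall z, Rabs (p z) <= Cmod z) ->
    (forall t : R, is_series (fun k => p ((Ci * t) ^ k / fact k)%C) (f t)) ->
    mom (fun t => f (w * (1 + t))) (r0_res n) I ->
    is_series (fun k => p ((Ci * (2 * w)%R) ^ k / fact k * RtoC (4 / ((n + 1) * (n + 3)) * (1 - uprod k (S n))))%C) I).
  { intros p f I Hp Hle Hf HI.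
    (* Halving [1 + t] keeps the test functions bounded by 1 on the interval; the compensating
       powers of 2 produce the argument [2 * w]. *)
    refine (is_series_eq _ _ _ _ _ eq_refl (is_series_mom (fun k t => ((1 + t) / 2) ^ k) (fun t => f (w * (1 + t))) (r0_res n)
      (fun k => p ((Ci * (2 * w)%R) ^ k / fact k)%C) (fun k => 4 / ((n + 1) * (n + 3)) * (1 - uprod k (S n))) I _ _ _ _ _ HI)).
    - intros k. now rewrite Hp.
    - intros k t Ht. apply abs_pow_le_1. apply Rabs_le. lra.
    - apply (ex_series_le (V := R_CompleteNormedModule) _ (fun k => Rabs (2 * w) ^ k / fact k)).
      + intros k. unfold norm; simpl; unfold abs; simpl. rewrite Rabs_Rabsolu.
        eapply Rle_trans; [apply Hle|]. unfold Cdiv. rewrite <- RtoC_inv_total, Cmod_mult, Cmod_pow, Cmod_mult, !Cmod_R.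
        rewrite Cmod_Ci, Rmult_1_l, (Rabs_pos_eq (/ _)); [apply Rle_refl|].
        left. apply Rinv_0_lt_compat, fact_pos.
      + eexists. apply is_series_exp.
    - intros t _. refine (is_series_eq _ _ _ _ _ eq_refl (Hf (w * (1 + t)))).
      intros k. rewrite <- Hp. f_equal.
      replace (w * (1 + t)) with ((2 * w) * ((1 + t) / 2)) by field.
      rewrite (RtoC_mult (2 * w)), Cmult_assoc, Cpow_mult_l, RtoC_pow. unfold Cdiv. ring.
    - apply continuous_r0_res.
    - intros k. pose proof (mom_r0_res_shifted n k) as H.
      pose proof (mom_lin _ _ _ _ _ (/ 2 ^ k) 0 H H) as H'.
      pose proof (pow_lt 2 k ltac:(lra)) as Hk.
      replace (4 / ((n + 1) * (n + 3)) * (1 - uprod k (S n))) with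
        (/ 2 ^ k * (2 ^ k * (4 / ((n + 1) * (n + 3))) * (1 - uprod k (S n))) + 0 * (2 ^ k * (4 / ((n + 1) * (n + 3))) * (1 - uprod k (S n))))
        by (posnat; field; lra).
      refine (mom_conv _ _ _ _ _ _ H'). intros t. unfold Rdiv. rewrite Rpow_mult_distr, pow_inv. ring. }
  split.
  - apply (P Re cos); trivial; [intros; apply re_scal_r | apply re_le_Cmod | intros t; apply (is_CSeries_exp t)].
  - apply (P Im sin); trivial; [intros; apply im_scal_r | | intros t; apply (is_CSeries_exp t)].
    intros z. rewrite <- Rabs_Ropp, <- re_mult_Ci.
    eapply Rle_trans; [apply re_le_Cmod|]. rewrite Cmod_mult, Cmod_Ci, Rmult_1_r. apply Rle_refl.
Qed.

(** * The three transforms *)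

Open Scope C_scope.

Lemma fourier_phi (n eps : nat) (w : R) : (1 <= n)%nat -> eps = 0%nat \/ eps = 1%nat ->
    fourier (phi (2 * n + eps)) w =
      (- Ci) ^ eps * fact (n - 1) / poch (n - 1 / 2 + eps) (n + 1)
        * cos (w - eps * (PI / 2))%R
      + (-1) ^ n * (- Ci) ^ eps * fact (n - 1)
          / (poch (n - 1 / 2 + eps) (n + 1) * poch (1 / 2) (2 * n + 2 + eps))
        * (w / 2) ^ (2 * n + 2 + eps)
        * pFq [] [2 * n + 5 / 2 + eps] (- (w / 2) ^ 2)
      + (-1) ^ (n - 1) * (- Ci) ^ eps * fact (n - 1)
          * (n + 1) * (n + 1 / 2 + eps)
          / (poch (n - 1 / 2 + eps) (n + 1) * poch (1 / 2) (2 * n + 1 + eps))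
        * (w / 2) ^ (2 * n + eps)
        * pFq [] [2 * n + 3 / 2 + eps] (- (w / 2) ^ 2).
Proof.
  (* From here on [N = n + 1] is the index of the statement, and [phi (2 * N + eps)] is
     [psi (2 * n + eps)]. *)
  intros Hn He. destruct n as [|n]; [lia|]. clear Hn.
  set (x := (- (w / 2) ^ 2)%R).
  set (N := S n).
  (* Partial fractions: the [j - N] in the last numerator of [psi_moment] completes [zprod] to
     length [N + 1], and the constant [(N + 1) * (N + 1 / 2 + eps)] leaves a product of length [N]
     with one extra pole. These are the two 0F1 terms. *)
  assert (Hs : is_series (fun j => x ^ j / (fact j * rpoch (1 / 2 + eps) j) * psi_moment eps n j)%R
    (psi_const (2 * n + eps) * (hyp01 (1 / 2 + eps) x - x ^ S N / rpoch (1 / 2 + eps) (2 * S N) * hyp01 (1 / 2 + eps + 2 * S N) x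
       - (N + 1) * (N + 1 / 2 + eps) * (x ^ N / rpoch (1 / 2 + eps) (2 * N + 1) * hyp01 (3 / 2 + eps + 2 * N) x)))%R).
  { refine (is_series_eq _ _ _ _ _ _ (is_series_Rmult _ (psi_const (2 * n + eps)) _ (is_series_lin _ _ 1 1 _ _
      (is_series_lin _ _ 1 (-1) _ _ (series_1 eps x) (series_zprod eps (S N) x))
      (is_series_lin _ _ (- ((N + 1) * (N + 1 / 2 + eps))) 0 _ _ (series_Y eps N x) (series_Y eps N x)))));
      [intros j | ring].
    unfold psi_moment. fold N. rewrite (zprod_S _ _ N). unfold N. rewrite !S_INR.
    pose proof (fact_pos j). pose proof (rpoch_pos (1 / 2 + eps) j ltac:(posnat; lra)). posnat. field. lra. }
  pose proof (fun j => psi_moments n j) as Hm.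
  rewrite (fun H1 H2 H3 H4 => fourier_parity eps (phi (2 * N + eps)) (psi (2 * n + eps)) w _ (psi_moment eps n) He H1 H2 H3 H4 Hs).
  2: { intros t. apply continuous_psi. }
  2: { intros t Ht. replace (2 * N + eps)%nat with (2 * n + eps + 2)%nat by (unfold N; lia). now apply phi_psi. }
  2: { intros j. destruct (Hm j) as (H0 & H1 & H2 & H3). destruct He as [-> | ->]; rewrite ?Nat.add_0_r; assumption. }
  2: { intros j. destruct (Hm j) as (H0 & H1 & H2 & H3).
       destruct He as [-> | ->]; simpl (1 - _)%nat; rewrite ?Nat.add_0_r; assumption. }
  (* With the power of [- Ci] set aside, the rest is real, so the constants are compared over the
     reals before the cast. *)
  set (r := (fact (N - 1) / rpoch (N - 1 / 2 + eps) (N + 1) * cos (w - eps * (PI / 2))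
      + (-1) ^ N * fact (N - 1) / (rpoch (N - 1 / 2 + eps) (N + 1) * rpoch (1 / 2) (2 * N + 2 + eps))
        * (w / 2) ^ (2 * N + 2 + eps) * hyp01 (2 * N + 5 / 2 + eps) x
      + (-1) ^ (N - 1) * fact (N - 1) * (N + 1) * (N + 1 / 2 + eps)
          / (rpoch (N - 1 / 2 + eps) (N + 1) * rpoch (1 / 2) (2 * N + 1 + eps))
        * (w / 2) ^ (2 * N + eps) * hyp01 (2 * N + 3 / 2 + eps) x)%R).
  transitivity ((- Ci) ^ eps * RtoC r).
  - replace (- (Ci * w)) with (- Ci * w) by ring.
    rewrite Cpow_mult_l, <- Cmult_assoc, <- RtoC_pow, <- RtoC_mult. do 2 f_equal.
    unfold r. rewrite trig_cos, trig_0F1, psi_const_closed by exact He. fold x. fold (hyp01 (1 / 2 + eps) x).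
    replace (2 * S N)%nat with (2 * N + 2)%nat by lia.
    replace (1 / 2 + eps + 2 * S N)%R with (2 * N + 5 / 2 + eps)%R by (rewrite S_INR; field).
    replace (3 / 2 + eps + 2 * N)%R with (2 * N + 3 / 2 + eps)%R by field.
    replace (n + 1 / 2 + eps)%R with (N - 1 / 2 + eps)%R by (unfold N; rewrite S_INR; field).
    replace (n + 2)%nat with (N + 1)%nat by (unfold N; lia).
    replace (N - 1)%nat with n by (unfold N; lia).
    unfold x. rewrite !pow_x. replace (2 * S N)%nat with (2 * N + 2)%nat by lia. fold x.
    assert (0 < rpoch (N - 1 / 2 + eps) (N + 1))%R by (apply rpoch_pos; unfold N; rewrite S_INR; posnat; lra).
    rewrite !pow_add.
    replace ((-1) ^ N)%R with (-1 * (-1) ^ n)%R by reflexivity.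
    destruct He as [-> | ->].
    + rewrite !Nat.add_0_r. change (INR 0) with 0%R in *. rewrite !Rplus_0_r in *.
      pose proof (rpoch_pos (1 / 2) (2 * N + 2) ltac:(lra)). pose proof (rpoch_pos (1 / 2) (2 * N + 1) ltac:(lra)).
      simpl ((-1) ^ S N)%R. replace ((-1) ^ N)%R with (-1 * (-1) ^ n)%R by reflexivity. field. lra.
    (* The series has Pochhammer symbols of 3/2, the statement has those of 1/2 with one factor
       more; the surplus 1/2 matches [w / 2] against [w]. *)
    + replace (2 * N + 2 + 1)%nat with (S (2 * N + 2)) by lia.
      replace (2 * N + 1 + 1)%nat with (S (2 * N + 1)) by lia. rewrite !rpoch_Sl.
      change (INR 1) with 1%R in *.
      pose proof (rpoch_pos (1 / 2 + 1) (2 * N + 2) ltac:(lra)). pose proof (rpoch_pos (1 / 2 + 1) (2 * N + 1) ltac:(lra)).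
      simpl ((-1) ^ S N)%R. replace ((-1) ^ N)%R with (-1 * (-1) ^ n)%R by reflexivity.
      simpl (_ ^ 1)%R. field. lra.
  - replace (N - 1 / 2 + eps) with (RtoC (N - 1 / 2 + eps)) by (push_RtoC; reflexivity).
    replace (RtoC 1 / RtoC 2) with (RtoC (1 / 2)) by (push_RtoC; reflexivity).
    replace (2 * N + 5 / 2 + eps) with (RtoC (2 * N + 5 / 2 + eps)) by (push_RtoC; reflexivity).
    replace (2 * N + 3 / 2 + eps) with (RtoC (2 * N + 3 / 2 + eps)) by (push_RtoC; reflexivity).
    replace (- (w / 2) ^ 2) with (RtoC x) by (unfold x; push_RtoC; reflexivity).
    rewrite !poch_RtoC, !pFq_hyp01. unfold r. push_RtoC. unfold Cdiv. ring.
Qed.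

Lemma Cexp_Ci (w : R) : Cexp (Ci * w) = (cos w, sin w).
Proof.
  unfold Cexp, Cmult, Ci, RtoC, Re, Im; simpl.
  replace (0 * w - 1 * 0)%R with 0%R by ring. replace (0 * 0 + 1 * w)%R with w by ring.
  rewrite exp_0. f_equal; ring.
Qed.

Lemma Cexp_Ci_neg (w : R) : Cexp (- (Ci * w)) = (cos w, - sin w)%R.
Proof.
  replace (- (Ci * w)) with (Ci * RtoC (- w)) by (rewrite RtoC_opp; ring).
  now rewrite Cexp_Ci, cos_neg, sin_neg.
Qed.

Lemma Ci_pow_even (n : nat) (w : R) : (2 * Ci * w) ^ (2 * n) = RtoC ((-1) ^ n * (2 * w) ^ (2 * n)).
Proof.
  rewrite Cpow_mult_r. replace ((2 * Ci * w) ^ 2) with (RtoC (-1 * (2 * w) ^ 2)).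
  - rewrite <- RtoC_pow, Rpow_mult_distr, <- pow_mult. reflexivity.
  - unfold Ci, RtoC, Cpow, Cmult; simpl. f_equal; ring.
Qed.

(** Cosine and sine moments contribute one 0F1 each. Which of them has the larger lower parameter
    depends on the parity of [n], as does the power of [Ci], hence the case split. *)
Lemma fourier_l0_0F1 (n : nat) (w : R) : (1 <= n)%nat ->
  fourier (l0 n) w =
      4 / (n * (n + 2)) * Cexp (Ci * w)
      - 4 * (-1) ^ n * Cexp (- (Ci * w)) / (n * (n + 1) * (n + 2))
      - 4 * fact (n - 1) * (2 * Ci * w) ^ (n + 1) / fact (2 * n + 2)
        * (Ci * w * n / ((n + 2) * (2 * n + 3))
             * pFq [] [n + 5 / 2] (- (w / 2) ^ 2)
           + pFq [] [n + 3 / 2] (- (w / 2) ^ 2)).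
Proof.
  intros Hn. destruct n as [|n]; [lia|]. clear Hn.
  pose proof (mom_trig_r0_moment 0 _ _ w (or_introl eq_refl) (continuous_r0_res n) (fun j => proj1 (r0_res_parity_moments n j))) as H0.
  pose proof (mom_trig_r0_moment 1 _ _ w (or_intror eq_refl) (continuous_r0_res n) (fun j => proj2 (r0_res_parity_moments n j))) as H1.
  pose proof (fourier_l0_pair _ _ _ _ H0 H1) as E.
  rewrite Nat.add_1_r in E. rewrite E. clear E H0 H1.
  set (x := (- (w / 2) ^ 2)%R).
  replace (- (w / 2) ^ 2) with (RtoC x) by (unfold x; push_RtoC; reflexivity).
  replace (S n + 5 / 2) with (RtoC (S n + 5 / 2)) by (push_RtoC; reflexivity).
  replace (S n + 3 / 2) with (RtoC (S n + 3 / 2)) by (push_RtoC; reflexivity).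
  rewrite !pFq_hyp01, Cexp_Ci, Cexp_Ci_neg.
  replace (S n - 1)%nat with n by lia.
  replace (4 / (S n * (S n + 2))) with (RtoC (4 / (S n * (S n + 2)))) by (push_RtoC; reflexivity).
  replace (4 * (-1) ^ S n * (cos w, - sin w)%R / (S n * (S n + 1) * (S n + 2)))
    with (RtoC (4 * (-1) ^ S n / (S n * (S n + 1) * (S n + 2))) * (cos w, - sin w)%R)
    by (push_RtoC; unfold Cdiv; ring).
  replace (Ci * w * S n / ((S n + 2) * (2 * S n + 3)) * hyp01 (S n + 5 / 2) x + hyp01 (S n + 3 / 2) x)
    with (RtoC (hyp01 (S n + 3 / 2) x) + Ci * RtoC (w * S n / ((S n + 2) * (2 * S n + 3)) * hyp01 (S n + 5 / 2) x))
    by (push_RtoC; unfold Cdiv; ring).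
  destruct (nat_parity n) as [i [-> | ->]].
  - replace (S (2 * i) + 1)%nat with (2 * S i)%nat by lia.
    rewrite Ci_pow_even.
    set (k := (4 * fact (2 * i) * ((-1) ^ S i * (2 * w) ^ (2 * S i)) / fact (2 * S (2 * i) + 2))%R).
    replace (4 * fact (2 * i) * RtoC ((-1) ^ S i * (2 * w) ^ (2 * S i))%R / fact (2 * S (2 * i) + 2))
      with (RtoC k) by (unfold k; push_RtoC; reflexivity).
    rewrite Nat.div2_succ_double, Nat.div2_double.
    assert (Ek : k = ((-1) ^ S i * (w / 2) ^ (2 * S i) / ((i + 1) * (i + 1 / 2)) / rpoch (1 / 2) (2 * S i))%R).
    { unfold k. replace (2 * S (2 * i) + 2)%nat with (2 * (2 * S i) + 0)%nat by lia.
      rewrite (fact_parity 0) by auto. change (INR 0) with 0%R. rewrite Rplus_0_r.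
      replace (2 * w)%R with (4 * (w / 2))%R by field.
      rewrite !Rpow_mult_distr. replace (fact (2 * S i)) with (fact (S (S (2 * i)))) by (f_equal; lia).
      rewrite !fact_S, S_INR, mult_INR. change (INR 2) with 2%R.
      pose proof (fact_pos (2 * i)). pose proof (rpoch_pos (1 / 2) (2 * S i) ltac:(lra)).
      pose proof (pow_lt 4 (2 * S i) ltac:(lra)). posnat. field. lra. }
    rewrite Ek. clear Ek k.
    replace (1 / 2 + 0%nat + 2 * S i)%R with (S (2 * i) + 3 / 2)%R by (rewrite !S_INR, mult_INR; simpl; field).
    replace (1 / 2 + 1%nat + 2 * S i)%R with (S (2 * i) + 5 / 2)%R by (rewrite !S_INR, mult_INR; simpl; field).
    replace (1 / 2 + 0%nat)%R with (1 / 2)%R by (simpl; ring).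
    replace (rpoch (1 / 2 + 1%nat) (2 * S i)) with (rpoch (1 / 2) (2 * S i) * (2 * (2 * i + 5 / 2)))%R.
    2: { pose proof (rpoch_Sl (1 / 2) (2 * S i)) as Q. rewrite rpoch_S, mult_INR in Q. change (INR 2) with 2%R in Q. rewrite S_INR in Q. change (INR 1) with 1%R.
         lra. }
    assert (Hr : (0 < rpoch (1 / 2) (2 * S i))%R) by (apply rpoch_pos; lra).
    assert (Hm : ((-1) ^ S (2 * i) = -1)%R) by (rewrite <- tech_pow_Rmult, pow_m1_even; ring).
    rewrite Hm. rewrite !S_INR, mult_INR. change (INR 2) with 2%R. change (INR 1) with 1%R. change (INR 0) with 0%R.
    fold x. unfold trig.
    generalize dependent (rpoch (1 / 2) (2 * S i)). intros p Hp.
    generalize (hyp01 (2 * i + 1 + 3 / 2) x) (hyp01 (2 * i + 1 + 5 / 2) x) (cos w) (sin w)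
      ((-1) ^ S i)%R ((w / 2) ^ (2 * S i))%R. intros f1 f2 c s sg q.
    unfold Cminus, Cplus, Copp, Cmult, Ci, RtoC; simpl. posnat. f_equal; field; lra.
  - replace (S (2 * i + 1) + 1)%nat with (S (2 * S i)) by lia.
    rewrite Cpow_S, Ci_pow_even.
    set (k := (8 * w * fact (2 * i + 1) * ((-1) ^ S i * (2 * w) ^ (2 * S i)) / fact (2 * S (2 * i + 1) + 2))%R).
    replace (4 * fact (2 * i + 1) * (2 * Ci * w * RtoC ((-1) ^ S i * (2 * w) ^ (2 * S i))%R) / fact (2 * S (2 * i + 1) + 2))
      with (Ci * RtoC k) by (unfold k; push_RtoC; replace (RtoC 8) with (RtoC 4 * RtoC 2) by (rewrite <- RtoC_mult; f_equal; ring); unfold Cdiv; ring).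
    replace (Nat.div2 (S (2 * i + 1))) with (S i)
      by (replace (S (2 * i + 1)) with (2 * S i)%nat by lia; now rewrite Nat.div2_double).
    replace (Nat.div2 (2 * i + 1)) with i by (now rewrite Nat.add_1_r, Nat.div2_succ_double).
    assert (Ek : k = (w * (-1) ^ S i * (w / 2) ^ (2 * S i) / ((i + 1) * (i + 3 / 2)) / rpoch (3 / 2) (2 * S i))%R).
    { unfold k. replace (2 * S (2 * i + 1) + 2)%nat with (2 * S (2 * S i) + 0)%nat by lia.
      rewrite (fact_parity 0) by auto. change (INR 0) with 0%R. rewrite Rplus_0_r, rpoch_Sl.
      replace (1 / 2 + 1)%R with (3 / 2)%R by field.
      replace (2 * w)%R with (4 * (w / 2))%R by field.
      rewrite !Rpow_mult_distr. simpl (4 ^ S _)%R. rewrite fact_S.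
      replace (fact (2 * S i)) with (fact (S (2 * i + 1))) by (f_equal; lia).
      change (4 * 4 ^ (i + S (i + 0)))%R with (4 ^ (2 * S i))%R.
      rewrite fact_S, !plus_INR, !mult_INR. change (INR 2) with 2%R. change (INR 1) with 1%R. rewrite !S_INR.
      pose proof (fact_pos (2 * i + 1)). pose proof (rpoch_pos (3 / 2) (2 * S i) ltac:(lra)).
      pose proof (pow_lt 4 (2 * S i) ltac:(lra)). posnat. field. lra. }
    rewrite Ek. clear Ek k.
    replace (1 / 2 + 0%nat + 2 * S (S i))%R with (S (2 * i + 1) + 5 / 2)%R by (rewrite !S_INR, plus_INR, mult_INR; simpl; field).
    replace (1 / 2 + 1%nat + 2 * S i)%R with (S (2 * i + 1) + 3 / 2)%R by (rewrite !S_INR, plus_INR, mult_INR; simpl; field).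
    replace (1 / 2 + 0%nat)%R with (1 / 2)%R by (simpl; ring).
    replace (1 / 2 + 1%nat)%R with (3 / 2)%R by (simpl; field).
    replace (2 * S (S i))%nat with (S (S (2 * S i))) by lia.
    rewrite rpoch_Sl. replace (1 / 2 + 1)%R with (3 / 2)%R by field. rewrite rpoch_S.
    assert (Hr : (0 < rpoch (3 / 2) (2 * S i))%R) by (apply rpoch_pos; lra).
    assert (Hm : ((-1) ^ S (2 * i + 1) = 1)%R) by (replace (S (2 * i + 1)) with (2 * S i)%nat by lia; apply pow_m1_even).
    rewrite Hm.
    replace ((w / 2) ^ S (S (2 * S i)))%R with ((w / 2) * (w / 2) * (w / 2) ^ (2 * S i))%R by (simpl; ring).
    replace ((-1) ^ S (S i))%R with (- (-1) ^ S i)%R by (simpl; ring).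
    rewrite mult_INR, !S_INR, plus_INR, mult_INR. change (INR 2) with 2%R. change (INR 1) with 1%R. change (INR 0) with 0%R.
    fold x. unfold trig.
    generalize dependent (rpoch (3 / 2) (2 * S i)). intros p Hp.
    generalize (hyp01 (2 * i + 1 + 1 + 3 / 2) x) (hyp01 (2 * i + 1 + 1 + 5 / 2) x) (cos w) (sin w)
      ((-1) ^ S i)%R ((w / 2) ^ (2 * S i))%R. intros f1 f2 c s sg q.
    unfold Cminus, Cplus, Copp, Cmult, Ci, RtoC; simpl. posnat. f_equal; field; lra.
Qed.

(** Multiplying the transform by [Cexp (Ci * w)] replaces the kernel by the exponential of
    [Ci * w * (1 + t)], whose expansion calls for the moments about -1. *)
Lemma fourier_l0_2F2 (n : nat) (w : R) : (1 <= n)%nat ->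
  fourier (l0 n) w =
      4 / (n * (n + 2)) * Cexp (Ci * w)
      - 4 * (-1) ^ n * Cexp (- (Ci * w)) / (n * (n + 1) * (n + 2))
      - 4 * fact (n - 1) * (2 * Ci * w) ^ (n + 1) * Cexp (- (Ci * w))
          / fact (2 * n + 2)
        * pFq [n + 1; n + 3] [n + 2; 2 * n + 3] (2 * Ci * w).
Proof.
  intros Hn. destruct n as [|n]; [lia|]. clear Hn. set (N := S n).
  destruct (ex_mom (fun t => trig 0 (w * t))%R (r0_res n) (continuous_trig 0 w) (continuous_r0_res n)) as [c Hc].
  destruct (ex_mom (fun t => trig 1 (w * t))%R (r0_res n) (continuous_trig 1 w) (continuous_r0_res n)) as [s Hs].
  pose proof (fourier_l0_pair _ _ _ _ Hc Hs) as E0. rewrite Nat.add_1_r in E0. fold N in E0. rewrite E0. clear E0.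
  unfold trig in Hc, Hs.
  (* The addition theorems give the real and imaginary parts of the transform multiplied by
     [Cexp (Ci * w)]. *)
  assert (Hc' : mom (fun t => cos (w * (1 + t)))%R (r0_res n) (cos w * c + - sin w * s)%R).
  { pose proof (mom_comb _ _ _ _ _ (cos w) (- sin w) Hc Hs) as H.
    refine (mom_weight _ _ _ _ _ H). intros t. cbv beta. rewrite Rmult_plus_distr_l, Rmult_1_r, cos_plus. ring. }
  assert (Hs' : mom (fun t => sin (w * (1 + t)))%R (r0_res n) (sin w * c + cos w * s)%R).
  { pose proof (mom_comb _ _ _ _ _ (sin w) (cos w) Hc Hs) as H.
    refine (mom_weight _ _ _ _ _ H). intros t. cbv beta. rewrite Rmult_plus_distr_l, Rmult_1_r, sin_plus. ring. }
  pose proof (mom_exp_shifted _ _ _ _ Hc' Hs') as HX. clear Hc Hs Hc' Hs'.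
  fold N in HX. set (X := (_, _)) in HX.
  set (K := (4 / ((n + 1) * (n + 3)))%R) in HX.
  assert (HK : (0 < K)%R) by (unfold K; apply Rdiv_lt_0_compat; [lra | posnat; nra]).
  pose proof (is_CSeries_exp (2 * w)) as Hexp.
  set (Y := (cos (2 * w), sin (2 * w))) in Hexp.
  (* The moments are [K * (1 - uprod k N)] up to powers of 2, so the exponential series minus [/ K]
     times the series of [X] isolates [uprod]. *)
  assert (HU : is_CSeries (fun k => (Ci * (2 * w)%R) ^ k / fact k * RtoC (uprod k N)) (Y + - / RtoC K * X)).
  { refine (is_CSeries_ext _ _ _ _ (is_CSeries_plus _ _ _ _ Hexp (is_CSeries_mult _ (- / RtoC K) _ HX))).
    intros k. generalize ((Ci * (2 * w)%R) ^ k / fact k). intros z. rewrite RtoC_mult, RtoC_minus. field. intros H. apply RtoC_inj in H. lra. }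
  apply (is_CSeries_drop _ N) in HU.
  2: { intros k Hk. rewrite uprod_zero by exact Hk. ring. }
  (* [Q] is the first surviving term, at [k = N + 1]; dividing the tail by it normalises the series
     to a 2F2. *)
  set (Q := RtoC (4 * fact n / (K * fact (2 * N + 2))) * (2 * Ci * w) ^ (N + 1)).
  set (P := pFq _ _ _).
  assert (E : Q * P = Y + - / RtoC K * X - RtoC (uprod 0 N)).
  { apply is_CSeries_factor.
    replace (Y + - / RtoC K * X - RtoC (uprod 0 N)) with
      (Y + - / RtoC K * X - (Ci * (2 * w)%R) ^ 0 / fact 0 * RtoC (uprod 0%nat N)).
    2: { generalize (Y + - / RtoC K * X). intros T. simpl. field. }
    refine (is_CSeries_ext _ _ _ _ HU). intros r. unfold Q.
    replace (Ci * (2 * w)%R) with (2 * Ci * w) by (rewrite RtoC_mult; ring).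
    replace (S N + r)%nat with (N + 1 + r)%nat at 1 by lia. rewrite Cpow_add_r.
    rewrite uprod_tail. unfold pochs, fold_right. rewrite !Cmult_1_r.
    replace (N + 1) with (RtoC (N + 1)) by (push_RtoC; reflexivity).
    replace (N + 3) with (RtoC ((N + 2)%nat + 1)) by (rewrite plus_INR; push_RtoC; simpl; push_RtoC; ring).
    replace (N + 2) with (RtoC ((N + 1)%nat + 1)) by (rewrite plus_INR; push_RtoC; simpl; push_RtoC; ring).
    replace (2 * N + 3) with (RtoC ((2 * N + 2)%nat + 1)) by (rewrite plus_INR, mult_INR; push_RtoC; simpl; push_RtoC; ring).
    rewrite !poch_RtoC, !rpoch_fact.
    generalize ((2 * Ci * w) ^ (N + 1)) ((2 * Ci * w) ^ r). intros z zr.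
    transitivity (z * zr * RtoC (/ fact (S N + r) *
      (fact (N + r) * fact (N + 2 + r) / (fact r * fact (2 * N + 2 + r)))));
      [push_RtoC; rewrite RtoC_inv_total; unfold Cdiv; ring|].
    transitivity (z * zr * RtoC (4 * fact n / (K * fact (2 * N + 2)) *
      ((fact (N + r) / fact N) * (fact (N + 2 + r) / fact (N + 2)) /
       ((fact (N + 1 + r) / fact (N + 1)) * (fact (2 * N + 2 + r) / fact (2 * N + 2)) * fact r))));
      [|push_RtoC; unfold Cdiv; ring].
    do 2 f_equal. replace (S N + r)%nat with (N + 1 + r)%nat by lia.
    assert (F1 : INR (fact (N + 2)) = ((N + 2) * fact (N + 1))%R).
    { replace (N + 2)%nat with (S (N + 1)) by lia. rewrite fact_S, plus_INR. change (INR 1) with 1%R. ring. }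
    assert (F2 : INR (fact (N + 1)) = ((N + 1) * fact N)%R) by (rewrite Nat.add_1_r; apply fact_S).
    assert (F3 : INR (fact N) = ((n + 1) * fact n)%R) by apply fact_S.
    rewrite F1, F2, F3. unfold K. replace (INR N) with (n + 1)%R by (symmetry; apply S_INR).
    pose proof (fact_pos n). pose proof (fact_pos r). pose proof (fact_pos (2 * N + 2)).
    pose proof (fact_pos (2 * N + 2 + r)). pose proof (fact_pos (N + 1 + r)).
    posnat. field. lra. }
  assert (EX : RtoC K * (Y - RtoC (uprod 0 N) - Q * P) = X).
  { rewrite E. field. intros H. apply RtoC_inj in H. lra. }
  assert (Ecs : Cexp (- (Ci * w)) * X = (c, s)).
  { rewrite Cexp_Ci_neg. unfold X, Cmult; simpl. pose proof (sin2_cos2 w) as H. unfold Rsqr in H.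
    f_equal.
    - transitivity ((sin w * sin w + cos w * cos w) * c)%R; [|rewrite H]; ring.
    - transitivity ((sin w * sin w + cos w * cos w) * s)%R; [|rewrite H]; ring. }
  assert (EY : Cexp (Ci * w) = Cexp (- (Ci * w)) * Y).
  { rewrite Cexp_Ci_neg, Cexp_Ci. unfold Y, Cmult; simpl.
    replace (2 * w)%R with (w + w)%R by ring. rewrite cos_plus, sin_plus.
    pose proof (sin2_cos2 w) as H. unfold Rsqr in H. f_equal.
    - transitivity ((sin w * sin w + cos w * cos w) * cos w)%R; [rewrite H|]; ring.
    - transitivity ((sin w * sin w + cos w * cos w) * sin w)%R; [rewrite H|]; ring. }
  assert (EK : RtoC K = 4 / (N * (N + 2))).
  { unfold K. replace ((n + 1) * (n + 3))%R with (N * (N + 2))%R by (unfold N; rewrite S_INR; ring).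
    push_RtoC. reflexivity. }
  assert (EKU : RtoC K * RtoC (uprod 0 N) = 4 * (-1) ^ N / (N * (N + 1) * (N + 2))).
  { rewrite uprod_0, <- RtoC_mult.
    replace (K * _)%R with (4 * (-1) ^ N / (N * (N + 1) * (N + 2)))%R; [push_RtoC; reflexivity|].
    unfold K. replace (n + 1)%R with (INR N) by apply S_INR.
    replace (n + 3)%R with (N + 2)%R by (unfold N; rewrite S_INR; ring).
    assert (0 < N)%R by (unfold N; rewrite S_INR; posnat; lra). field. lra. }
  assert (EKQ : RtoC K * Q = 4 * fact n * (2 * Ci * w) ^ (N + 1) / fact (2 * N + 2)).
  { unfold Q. rewrite Cmult_assoc, <- RtoC_mult.
    replace (K * _)%R with (4 * fact n / fact (2 * N + 2))%R
      by (pose proof (fact_pos (2 * N + 2)); field; lra).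
    push_RtoC. unfold Cdiv. ring. }
  replace (N - 1)%nat with n by (unfold N; lia).
  rewrite <- Ecs, <- EX. clearbody P.
  transitivity (RtoC K * (Cexp (- (Ci * w)) * Y) - RtoC K * RtoC (uprod 0 N) * Cexp (- (Ci * w))
    - RtoC K * Q * Cexp (- (Ci * w)) * P); [ring|].
  rewrite EKU, EKQ, EK, <- EY. unfold Cdiv. ring.
Qed.

Lemma fourier_u (n m eps : nat) (w : R) : eps = 0%nat \/ eps = 1%nat ->
    fourier (u (2 * n + 1 + eps) (2 * Z.of_nat n - 2 * Z.of_nat m)) w =
      - (- (Ci * w)) ^ eps * poch (- m - 1 / 2) (n + 1)
          / (poch (m + eps + 1) (n + 2) * poch (1 / 2 + eps) (2 * n + 2))
        * (w / 2) ^ (2 * n + 2)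
        * pFq [n + m + eps + 2] [n + m + eps + 3; 2 * n + 5 / 2 + eps]
            (- (w / 2) ^ 2)
      - (- (Ci * w)) ^ eps * ((-1) ^ n * poch (- m - 1 / 2) (n + 1))
          / (poch (m + 1 + eps) (n + 1) * (n + 1) * (1 / 2 + eps + n))
        * pFq [] [1 / 2 + eps] (- (w / 2) ^ 2)
      - (- (Ci * w)) ^ eps * poch (- m - 1 / 2) (n + 1)
          / ((n + 1) * (1 / 2 + eps + n) * poch (m + 1 + eps) (n + 1)
             * poch (1 / 2 + eps) (2 * n + 2))
        * (w / 2) ^ (2 * n + 2)
        * pFq [] [2 * n + 5 / 2 + eps] (- (w / 2) ^ 2).
Proof.
  intros He.
  set (x := (- (w / 2) ^ 2)%R).
  (* With [j = n + 1 + r], the pole [j + m + 1 + eps] of [u_moment] becomes [r + a]. *)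
  set (a := (n + m + eps + 2)%R).
  assert (Ha : (0 < a)%R) by (unfold a; posnat; lra).
  assert (Hs : is_series (fun j => x ^ j / (fact j * rpoch (1 / 2 + eps) j) * u_moment eps m n j)%R
    (u_const eps m n * (hyp01 (1 / 2 + eps) x
       - x ^ S n / rpoch (1 / 2 + eps) (2 * S n) * hyp01 (1 / 2 + eps + 2 * S n) x
       - (n + 1) * (n + 1 / 2 + eps) *
           (x ^ S n / rpoch (1 / 2 + eps) (2 * S n) * (hyp12 a (1 / 2 + eps + 2 * S n) x / a))))%R).
  { refine (is_series_eq _ _ _ _ _ _ (is_series_Rmult _ (u_const eps m n) _ (is_series_lin _ _ 1 1 _ _
      (is_series_lin _ _ 1 (-1) _ _ (series_1 eps x) (series_zprod eps (S n) x))
      (is_series_lin _ _ (- ((n + 1) * (n + 1 / 2 + eps))) 0 _ _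
        (series_zprod_pole eps (S n) a x Ha) (series_zprod_pole eps (S n) a x Ha)))));
      [intros j | ring].
    unfold u_moment, a. rewrite !S_INR.
    pose proof (fact_pos j). pose proof (rpoch_pos (1 / 2 + eps) j ltac:(posnat; lra)). posnat. field. lra. }
  rewrite (fun H1 H2 H3 H4 => fourier_parity eps (u (2 * n + 1 + eps) (2 * Z.of_nat n - 2 * Z.of_nat m))
    (u_res eps m n) w _ (u_moment eps m n) He H1 H2 H3 H4 Hs).
  2: { intros t. now apply continuous_u_res. }
  2: { intros t Ht. now apply u_eq_res. }
  2: { intros j. exact (proj1 (u_res_moments eps m n j He)). }
  2: { intros j. exact (proj2 (u_res_moments eps m n j He)). }
  set (r := (- rpoch (- m - 1 / 2) (n + 1)
          / (rpoch (m + eps + 1) (n + 2) * rpoch (1 / 2 + eps) (2 * n + 2))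
        * (w / 2) ^ (2 * n + 2) * hyp12 a (2 * n + 5 / 2 + eps) x
      - ((-1) ^ n * rpoch (- m - 1 / 2) (n + 1))
          / (rpoch (m + 1 + eps) (n + 1) * (n + 1) * (1 / 2 + eps + n))
        * hyp01 (1 / 2 + eps) x
      - rpoch (- m - 1 / 2) (n + 1)
          / ((n + 1) * (1 / 2 + eps + n) * rpoch (m + 1 + eps) (n + 1)
             * rpoch (1 / 2 + eps) (2 * n + 2))
        * (w / 2) ^ (2 * n + 2)
        * hyp01 (2 * n + 5 / 2 + eps) x)%R).
  transitivity ((- (Ci * w)) ^ eps * RtoC r).
  - do 2 f_equal. unfold r. rewrite u_const_closed.
    replace (1 / 2 + eps + 2 * S n)%R with (2 * n + 5 / 2 + eps)%R by (rewrite S_INR; field).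
    unfold x at 2 4. rewrite !pow_x. fold x.
    replace (2 * S n)%nat with (2 * n + 2)%nat by lia.
    replace (m + eps + 1)%R with (m + 1 + eps)%R by ring.
    replace (n + 2)%nat with (S (n + 1)) by lia. rewrite (rpoch_S (m + 1 + eps)), plus_INR.
    change (INR 1) with 1%R.
    pose proof (rpoch_pos (m + 1 + eps) (n + 1) ltac:(posnat; lra)).
    pose proof (rpoch_pos (1 / 2 + eps) (2 * n + 2) ltac:(posnat; lra)).
    simpl ((-1) ^ S n)%R. unfold a.
    (* The sign of [u_const] meets the sign of the power of [x]; [field] does not know that it
       squares to 1, so both of its values are tried. *)
    assert (E : ((-1) ^ n * (-1) ^ n = 1)%R) by apply pow_m1_e2.
    set (s := ((-1) ^ n)%R) in *. clearbody s.
    assert (Es : (s = 1 \/ s = -1)%R).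
    { assert ((s - 1) * (s + 1) = 0)%R as Hsg by lra. apply Rmult_integral in Hsg. lra. }
    clear - H H0 Es.
    generalize dependent (rpoch (m + 1 + eps) (n + 1)). generalize dependent (rpoch (1 / 2 + eps) (2 * n + 2)).
    generalize (rpoch (- m - 1 / 2) (n + 1)) (hyp12 (n + m + eps + 2) (2 * n + 5 / 2 + eps) x)
      (hyp01 (2 * n + 5 / 2 + eps) x) (hyp01 (1 / 2 + eps) x) ((w / 2) ^ (2 * n + 2))%R.
    intros.
    posnat. destruct Es as [-> | ->]; field; lra.
  - replace (- m - 1 / 2) with (RtoC (- m - 1 / 2)) by (push_RtoC; reflexivity).
    replace (m + eps + 1) with (RtoC (m + eps + 1)) by (push_RtoC; reflexivity).
    replace (m + 1 + eps) with (RtoC (m + 1 + eps)) by (push_RtoC; reflexivity).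
    replace (n + m + eps + 2) with (RtoC a) by (unfold a; push_RtoC; reflexivity).
    replace (n + m + eps + 3) with (RtoC (a + 1)) by (unfold a; push_RtoC; ring).
    replace (2 * n + 5 / 2 + eps) with (RtoC (2 * n + 5 / 2 + eps)) by (push_RtoC; reflexivity).
    rewrite <- (RtoC_div_total 1 2).
    rewrite <- (RtoC_plus (1 / 2) eps).
    replace (- (w / 2) ^ 2) with (RtoC x) by (unfold x; push_RtoC; reflexivity).
    rewrite !poch_RtoC, !pFq_hyp01, pFq_hyp12 by (posnat; lra). unfold r. push_RtoC. unfold Cdiv. ring.
Qed.

Theorem theorem18 :
  (forall (n eps : nat) (w : R), (1 <= n)%nat -> eps = 0%nat \/ eps = 1%nat ->
    fourier (phi (2 * n + eps)) w =
      (- Ci) ^ eps * fact (n - 1) / poch (n - 1 / 2 + eps) (n + 1)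
        * cos (w - eps * (PI / 2))%R
      + (-1) ^ n * (- Ci) ^ eps * fact (n - 1)
          / (poch (n - 1 / 2 + eps) (n + 1) * poch (1 / 2) (2 * n + 2 + eps))
        * (w / 2) ^ (2 * n + 2 + eps)
        * pFq [] [2 * n + 5 / 2 + eps] (- (w / 2) ^ 2)
      + (-1) ^ (n - 1) * (- Ci) ^ eps * fact (n - 1)
          * (n + 1) * (n + 1 / 2 + eps)
          / (poch (n - 1 / 2 + eps) (n + 1) * poch (1 / 2) (2 * n + 1 + eps))
        * (w / 2) ^ (2 * n + eps)
        * pFq [] [2 * n + 3 / 2 + eps] (- (w / 2) ^ 2))
  /\
  (forall (n : nat) (w : R), (2 <= n)%nat ->
    fourier (l0 n) w =
      4 / (n * (n + 2)) * Cexp (Ci * w)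
      - 4 * (-1) ^ n * Cexp (- (Ci * w)) / (n * (n + 1) * (n + 2))
      - 4 * fact (n - 1) * (2 * Ci * w) ^ (n + 1) * Cexp (- (Ci * w))
          / fact (2 * n + 2)
        * pFq [n + 1; n + 3] [n + 2; 2 * n + 3] (2 * Ci * w)
    /\
    fourier (l0 n) w =
      4 / (n * (n + 2)) * Cexp (Ci * w)
      - 4 * (-1) ^ n * Cexp (- (Ci * w)) / (n * (n + 1) * (n + 2))
      - 4 * fact (n - 1) * (2 * Ci * w) ^ (n + 1) / fact (2 * n + 2)
        * (Ci * w * n / ((n + 2) * (2 * n + 3))
             * pFq [] [n + 5 / 2] (- (w / 2) ^ 2)
           + pFq [] [n + 3 / 2] (- (w / 2) ^ 2)))
  /\
  (forall (n m eps : nat) (w : R), eps = 0%nat \/ eps = 1%nat ->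
    (2 <= 2 * n + 1 + eps)%nat ->
    fourier (u (2 * n + 1 + eps) (2 * Z.of_nat n - 2 * Z.of_nat m)) w =
      - (- (Ci * w)) ^ eps * poch (- m - 1 / 2) (n + 1)
          / (poch (m + eps + 1) (n + 2) * poch (1 / 2 + eps) (2 * n + 2))
        * (w / 2) ^ (2 * n + 2)
        * pFq [n + m + eps + 2] [n + m + eps + 3; 2 * n + 5 / 2 + eps]
            (- (w / 2) ^ 2)
      - (- (Ci * w)) ^ eps * ((-1) ^ n * poch (- m - 1 / 2) (n + 1))
          / (poch (m + 1 + eps) (n + 1) * (n + 1) * (1 / 2 + eps + n))
        * pFq [] [1 / 2 + eps] (- (w / 2) ^ 2)
      - (- (Ci * w)) ^ eps * poch (- m - 1 / 2) (n + 1)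
          / ((n + 1) * (1 / 2 + eps + n) * poch (m + 1 + eps) (n + 1)
             * poch (1 / 2 + eps) (2 * n + 2))
        * (w / 2) ^ (2 * n + 2)
        * pFq [] [2 * n + 5 / 2 + eps] (- (w / 2) ^ 2)).
Proof.
  split; [exact fourier_phi|]. split.
  - intros n w Hn. split; [apply fourier_l0_2F2 | apply fourier_l0_0F1]; lia.
  - intros n m eps w He _. now apply fourier_u.
Qed.
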